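(* Let $P\subset\mathbb{R}^d$ be a rational $d$-polytope containing the origin in its interior, let $T$ be a boundary triangulation of $P$ with denominator $q$, and define $h^*(P;z)$ by $\mathrm{Ehr}(P;z)=\frac{h^*(P;z)}{(1-z^q)^{d+1}}$. Set $$a(z)=(1+z+\cdots+z^{q-1})\sum_{\Omega\in T}B(\Omega;z)\,h(\Omega;z^q),\qquad b(z)=z^{-1}(1+z+\cdots+z^{q-1})\sum_{\Omega\in T}B(\Omega';z)\,h(\Omega;z^q),$$ so that $h^*(P;z)=a(z)+z\,b(z)$. Then the dual polytope $P^*=\{\mathbf{y}:\langle\mathbf{x},\mathbf{y}\rangle\le1\ \forall\mathbf{x}\in P\}$ is a lattice polytope if and only if $b(z)=0$, i.e., if and only if $h^*(P;z)=a(z)$.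
   Context: $\mathrm{Ehr}(P;z)=\sum_{t\ge0}|tP\cap\mathbb{Z}^d|z^t$. A boundary triangulation $T$ of $P$ is a simplicial complex of simplices (including the empty simplex, of dimension $-1$) whose union is $\partial P$; its denominator $q$ is the lcm of vertex coordinate denominators of its simplices. Let $u$ be the last-coordinate projection on $\mathbb{R}^{d+1}$. For linearly independent $\mathbf{W}\subset\mathbb{Z}^{d+1}$, $B(\mathbf{W};z)=\sum z^{u(\mathbf{v})}$ over integer points $\mathbf{v}$ of $\{\sum_{\mathbf{w}\in\mathbf{W}}\lambda_{\mathbf{w}}\mathbf{w}:0<\lambda_{\mathbf{w}}<1\}$ ($0$ if none; $B(\emptyset;z)=1$). For $\Omega\in T$ with vertices $\mathbf{r}_1/q,\dots,\mathbf{r}_{m+1}/q$ ($\mathbf{r}_i\in\mathbb{Z}^d$), let $\mathbf{W}=\{(\mathbf{r}_i,q)\}$, $B(\Omega;z)=B(\mathbf{W};z)$ and $B(\Omega';z)=B(\mathbf{W}\cup\{(\mathbf{0},1)\};z)$ (so $B(\emptyset';z)=B(\{(\mathbf{0},1)\};z)=0$). The $h$-polynomial is $h(\Omega;z)=(1-z)^{d-1-\dim\Omega}\sum_{\Omega\subseteq\Phi\in T}\left(\frac{z}{1-z}\right)^{\dim\Phi-\dim\Omega}$. *)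

(* Defs.v *)
From HB Require Import structures.
From mathcomp Require Export all_boot all_order all_algebra fraction finmap.
From mathcomp Require Export all_classical all_reals topology normedtype.

Set Implicit Arguments.
Unset Strict Implicit.
Unset Printing Implicit Defensive.

Export Order.TTheory GRing.Theory Num.Theory.
Export numFieldNormedType.Exports.

Global Open Scope classical_set_scope.
Global Open Scope ring_scope.

Section Geometry.
Variables (R : realType) (d : nat).

Definition rat_to_real (v : 'rV[rat]_d) : 'rV[R]_d := map_mx ratr v.
Definition int_to_real (v : 'rV[int]_d) : 'rV[R]_d := map_mx intr v.

Definition conv (A : {fset 'rV[R]_d}) : set 'rV[R]_d :=
  [set x | exists lam : 'rV[R]_d -> R,
    [/\ forall v, v \in A -> 0 <= lam v,
        \sum_(v <- A) lam v = 1 &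
        x = \sum_(v <- A) lam v *: v]].

Definition affinely_independent (A : {fset 'rV[R]_d}) : Prop :=
  forall lam : 'rV[R]_d -> R,
    \sum_(v <- A) lam v = 0 -> \sum_(v <- A) lam v *: v = 0 ->
    forall v, v \in A -> lam v = 0.

Definition rational_polytope (P : set 'rV[R]_d) : Prop :=
  exists A : {fset 'rV[rat]_d}, P = conv [fset rat_to_real v | v in A]%fset.

Definition lattice_polytope (P : set 'rV[R]_d) : Prop :=
  exists A : {fset 'rV[int]_d}, P = conv [fset int_to_real v | v in A]%fset.

Definition dual (P : set 'rV[R]_d) : set 'rV[R]_d :=
  [set y | forall x, P x -> \sum_(i < d) x 0 i * y 0 i <= 1].

Definition boundary (P : set 'rV[R]_d) : set 'rV[R]_d :=
  closure P `\` interior P.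

(* |tP \cap Z^d| *)
Definition lattice_count (P : set 'rV[R]_d) (t : nat) : nat :=
  #|` fset_set [set v : 'rV[int]_d |
        ((fun x => t%:R *: x) @` P) (int_to_real v)]|.

(* Ehr(P;z) = hs(z) / (1 - z^q)^(d+1), as an identity of formal power series:
   the left-hand side is the n-th coefficient of (1 - z^q)^(d+1) Ehr(P;z). *)
Definition is_hstar (P : set 'rV[R]_d) (q : nat) (hs : {poly rat}) : Prop :=
  forall n : nat,
    \sum_(k < n.+1)
      ((1 - 'X^q) ^+ d.+1 : {poly rat})`_k * (lattice_count P (n - k))%:R
    = hs`_n.

(* A simplex is given by its vertex set, so dim Om = #|` Om| - 1 and the faces
   of Om are its subsets; [conv fset0] is empty. *)
Definition simplex (Om : {fset 'rV[rat]_d}) : {fset 'rV[R]_d} :=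
  [fset rat_to_real v | v in Om]%fset.

Definition boundary_triangulation
    (P : set 'rV[R]_d) (T : {fset {fset 'rV[rat]_d}}) : Prop :=
  [/\ fset0 \in T,
      forall Om, Om \in T -> affinely_independent (simplex Om),
      forall Om Psi, Om \in T -> (Psi `<=` Om)%fset -> Psi \in T,
      forall Om Phi, Om \in T -> Phi \in T ->
        exists Psi, [/\ (Psi `<=` Om)%fset, (Psi `<=` Phi)%fset &
          conv (simplex Om) `&` conv (simplex Phi) = conv (simplex Psi)] &
      \bigcup_(Om in [set` T]) conv (simplex Om) = boundary P].

End Geometry.

Definition denominator (d : nat) (T : {fset {fset 'rV[rat]_d}}) : nat :=
  \big[lcmn/1%N]_(Om <- T) \big[lcmn/1%N]_(v <- Om)
    \big[lcmn/1%N]_(i < d) absz (denq (v 0 i)).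

Notation ratfun := {fraction {poly rat}}.
Definition polyF (p : {poly rat}) : ratfun := tofrac p.

Section BoxPolynomials.
Variables (R : realType) (d : nat).

Definition u (v : 'rV[int]_(d + 1)) : int := v 0 (rshift d ord0).

Definition open_box (W : {fset 'rV[int]_(d + 1)}) : set 'rV[int]_(d + 1) :=
  [set v | exists lam : 'rV[int]_(d + 1) -> R,
    (forall w, w \in W -> 0 < lam w < 1) /\
    int_to_real R v = \sum_(w <- W) lam w *: int_to_real R w].

Definition boxB (W : {fset 'rV[int]_(d + 1)}) (z : ratfun) : ratfun :=
  \sum_(v \in open_box W) z ^ u v.

(* (r, q) with v = r / q; [numq] reads off the integer q * v_i. *)
Definition lift_vertex (q : nat) (v : 'rV[rat]_d) : 'rV[int]_(d + 1) :=
  row_mx (\row_i numq (q%:R * v 0 i)) (const_mx q%:Z).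

Definition apex : 'rV[int]_(d + 1) := row_mx 0 (const_mx 1).

Definition coneW (q : nat) (Om : {fset 'rV[rat]_d}) : {fset 'rV[int]_(d + 1)} :=
  [fset lift_vertex q v | v in Om]%fset.

Definition B (q : nat) (Om : {fset 'rV[rat]_d}) (z : ratfun) : ratfun :=
  boxB (coneW q Om) z.

Definition B' (q : nat) (Om : {fset 'rV[rat]_d}) (z : ratfun) : ratfun :=
  boxB (apex |` coneW q Om)%fset z.

(* d - 1 - dim Om = d - #|` Om|, which is nonnegative for the simplices of a
   boundary triangulation. *)
Definition h (T : {fset {fset 'rV[rat]_d}}) (Om : {fset 'rV[rat]_d})
    (z : ratfun) : ratfun :=
  (1 - z) ^+ (d - #|` Om|) *
  \sum_(Phi <- T | (Om `<=` Phi)%fset) (z / (1 - z)) ^+ (#|` Phi| - #|` Om|).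

Definition a_fun (T : {fset {fset 'rV[rat]_d}}) (z : ratfun) : ratfun :=
  let q := denominator T in
  (\sum_(i < q) z ^+ i) * \sum_(Om <- T) B q Om z * h T Om (z ^+ q).

Definition b_fun (T : {fset {fset 'rV[rat]_d}}) (z : ratfun) : ratfun :=
  let q := denominator T in
  z^-1 * (\sum_(i < q) z ^+ i) * \sum_(Om <- T) B' q Om z * h T Om (z ^+ q).

End BoxPolynomials.

(* Main.v *)
(** Each simplex of [T] lies in a hyperplane [<., y> = 1] with [y] in [P*].  So if [x] is a
    positive combination [sum lam_v v] of the vertices of a simplex, then [s(x) := sum lam_v]
    is the maximum of [<x, .>] over [P*], and [x] lies in [tP] iff [s(x) <= t].  The relatively
    open cones over the simplices of [T] partition space; writing each coordinate of an integer
    point [(x, t)] of the cone over [P] as its fractional part plus an integer gives the formula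
    for [h*(P; z)], and shows that, up to the factor [(1 - z^q)^(d+1)], the series [z b(z)]
    counts the points with [t - s(x)] not an integer.  Hence [b = 0] iff [s] is integral on
    [Z^d].  This holds when [P*] is a lattice polytope; conversely [s] is linear on each
    full-dimensional cone, integrality makes these linear forms integral, and [P*] is the convex
    hull of the forms. *)

From HB Require Import structures.
From mathcomp Require Import interval_inference derive convex.
Require Import Defs.
From mathcomp Require Import ring lra zify.

Set Implicit Arguments.
Unset Strict Implicit.
Unset Printing Implicit Defensive.

(** * The scalar product and finite families of vectors *)

Section Dot.
Variables (K : comNzRingType) (d : nat).
Implicit Types x y f : 'rV[K]_d.

Definition dot x y : K := \sum_(i < d) x 0 i * y 0 i.

Lemma dotC x y : dot x y = dot y x.
Proof. by apply: eq_bigr => i _; rewrite mulrC. Qed.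

Fact dot_is_scalar x : scalar (dot x).
Proof.
move=> a y f; rewrite /dot mulr_sumr -big_split; apply: eq_bigr => i _ /=.
by rewrite !mxE; ring.
Qed.

HB.instance Definition _ x :=
  GRing.isLinear.Build K 'rV[K]_d K _ (dot x) (dot_is_scalar x).

Lemma dotDr x y f : dot f (x + y) = dot f x + dot f y.
Proof. exact: linearD. Qed.

Lemma dotBr x y f : dot f (x - y) = dot f x - dot f y.
Proof. exact: linearB. Qed.

Lemma dotZr a x f : dot f (a *: x) = a * dot f x.
Proof. exact: linearZ. Qed.

Lemma dot0r f : dot f 0 = 0.
Proof. exact: linear0. Qed.

Lemma dot0l f : dot 0 f = 0.
Proof. by rewrite dotC dot0r. Qed.

Lemma dotDl x y f : dot (x + y) f = dot x f + dot y f.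
Proof. by rewrite !(dotC _ f) dotDr. Qed.

Lemma dotBl x y f : dot (x - y) f = dot x f - dot y f.
Proof. by rewrite !(dotC _ f) dotBr. Qed.

Lemma dotZl a x f : dot (a *: x) f = a * dot x f.
Proof. by rewrite !(dotC _ f) dotZr. Qed.

Lemma dot_sqrBZ f y a : dot (f - a *: y) (f - a *: y) =
  dot f f - a * dot y f *+ 2 + a ^+ 2 * dot y y.
Proof. by rewrite dotBr !dotBl !dotZr !dotZl (dotC f y); ring. Qed.

Lemma dot_suml (I : Type) (s : seq I) (lam : I -> K) (g : I -> 'rV[K]_d) f :
  dot (\sum_(i <- s) lam i *: g i) f = \sum_(i <- s) lam i * dot (g i) f.
Proof.
by rewrite dotC linear_sum; apply: eq_bigr => i _; rewrite linearZ dotC.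
Qed.

Lemma dot_suml_eq1 (I : eqType) (s : seq I) (lam : I -> K) (g : I -> 'rV[K]_d) f :
  (forall i, i \in s -> dot (g i) f = 1) ->
  dot (\sum_(i <- s) lam i *: g i) f = \sum_(i <- s) lam i.
Proof.
by move=> gf1; rewrite dot_suml; apply: eq_big_seq => i /gf1 ->; rewrite mulr1.
Qed.

Lemma dot_delta i f : dot (delta_mx 0 i) f = f 0 i.
Proof.
rewrite /dot (bigD1 i) //= mxE !eqxx mul1r big1 ?addr0 // => j ji.
by rewrite mxE (negPf ji) mul0r.
Qed.

End Dot.

Lemma dot_gt0 (R : realDomainType) d (x : 'rV[R]_d) : (0 < dot x x) = (x != 0).
Proof.
have sqr_ge i : 0 <= x 0 i * x 0 i by rewrite -expr2 sqr_ge0.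
rewrite lt_def sumr_ge0 ?andbT // psumr_eq0 //; congr (~~ _).
apply/allP/eqP => [x0|-> i _]; last by rewrite mxE mul0r eqxx.
apply/rowP => i; have := x0 i (mem_index_enum i).
by rewrite mulf_eq0 orbb mxE => /eqP.
Qed.

Lemma continuous_sum (K : numFieldType) (V : normedModType K) (T : topologicalType)
    (I : Type) (s : seq I) (F : I -> T -> V) :
  (forall i, continuous (F i)) -> continuous (fun x => \sum_(i <- s) F i x).
Proof.
by move=> Fc; apply: (@continuous_big _ _ _ _ xpredT (@add_continuous V)) => i _.
Qed.

Lemma dot_continuous (R : realType) d (f : 'rV[R]_d) : continuous (dot f).
Proof.
apply: (@continuous_sum _ R^o _ _ _ (fun i (x : 'rV[R]_d) => f 0 i * x 0 i)) => i x.
by apply: continuousM; [exact: cst_continuous|exact: coord_continuous].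
Qed.

Section Families.
Variables (K : fieldType) (d : nat) (I : choiceType) (S : {fset I}).
Variable g : I -> 'rV[K]_d.

Definition linearly_independent := forall lam : I -> K,
  \sum_(v <- S) lam v *: g v = 0 -> forall v, v \in S -> lam v = 0.

Definition family_mx : 'M[K]_(#|{: S}|, d) := \matrix_i g (fsval (enum_val i)).

Definition coord_row (lam : I -> K) : 'rV[K]_#|{: S}| :=
  \row_i lam (fsval (enum_val i)).

Lemma sum_enum_val (V : nmodType) (F : I -> V) :
  \sum_(i < #|{: S}|) F (fsval (enum_val i)) = \sum_(v <- S) F v.
Proof.
rewrite big_seq_fsetE /=; apply/esym/reindex; exists enum_rank => i _.
  exact: enum_valK.
exact: enum_rankK.
Qed.

Lemma coord_row_mul lam : coord_row lam *m family_mx = \sum_(v <- S) lam v *: g v.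
Proof.
rewrite mulmx_sum_row -[RHS]sum_enum_val; apply: eq_bigr => i _.
by rewrite mxE rowK.
Qed.

Lemma coord_row_surj (l : 'rV[K]_#|{: S}|) : exists lam, l = coord_row lam.
Proof.
exists (fun v => if insub v is Some s then l 0 (enum_rank s) else 0).
by apply/rowP => i; rewrite mxE valK enum_valK.
Qed.

Lemma coord_row_eq0 lam : coord_row lam = 0 <-> forall v, v \in S -> lam v = 0.
Proof.
split=> [/rowP lam0 v vS|lam0].
  by have := lam0 (enum_rank [` vS]%fset); rewrite !mxE enum_rankK.
by apply/rowP => i; rewrite !mxE lam0 // fsvalP.
Qed.

Hypothesis indep : linearly_independent.

Lemma family_mx_free : row_free family_mx.
Proof.
apply: inj_row_free => l; have [lam ->] := coord_row_surj l.
by rewrite coord_row_mul => /indep/coord_row_eq0.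
Qed.

Lemma independent_card_le : (#|` S| <= d)%N.
Proof. by rewrite cardfE -(eqP family_mx_free) rank_leq_col. Qed.

Lemma independent_spanning : #|` S| = d ->
  forall x, exists lam : I -> K, x = \sum_(v <- S) lam v *: g v.
Proof.
rewrite cardfE => Sd x; have Mfull : row_full family_mx.
  by rewrite /row_full (eqP family_mx_free) Sd.
have /submxP[l ->] := submx_full x Mfull.
by have [lam ->] := coord_row_surj l; exists lam; rewrite coord_row_mul.
Qed.

Lemma independent_interpolation (val : I -> K) :
  exists f, forall v, v \in S -> dot (g v) f = val v.
Proof.
have [N MN] := row_freeP family_mx_free.
exists (N *m (coord_row val)^T)^T => v vS.
have /matrixP/(_ (enum_rank [` vS]%fset) 0) :
    family_mx *m (N *m (coord_row val)^T) = (coord_row val)^T.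
  by rewrite mulmxA MN mul1mx.
rewrite !mxE enum_rankK => <-; apply: eq_bigr => j _.
by rewrite !mxE enum_rankK.
Qed.

Lemma independent_annihilator : (#|` S| < d)%N ->
  exists2 f, f != 0 & forall v, v \in S -> dot (g v) f = 0.
Proof.
rewrite cardfE => Sd; exists (nz_row (kermx family_mx^T)).
  rewrite nz_row_eq0 -mxrank_eq0 mxrank_ker mxrank_tr (eqP family_mx_free).
  by rewrite subn_eq0 -ltnNge.
have /sub_kermxP/matrixP fM := nz_row_sub (kermx family_mx^T) => v vS.
have := fM 0 (enum_rank [` vS]%fset); rewrite !mxE dotC => fv0; rewrite -[RHS]fv0.
by apply: eq_bigr => j _; rewrite !mxE enum_rankK.
Qed.

End Families.

Lemma independent_coord_unique (K : fieldType) d (I : choiceType) (S : {fset I})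
    (g : I -> 'rV[K]_d) (lam mu : I -> K) : linearly_independent S g ->
  \sum_(v <- S) lam v *: g v = \sum_(v <- S) mu v *: g v ->
  forall v, v \in S -> lam v = mu v.
Proof.
move=> indep eq_lm v vS; apply/eqP; rewrite -subr_eq0; apply/eqP.
apply: (indep (fun w => lam w - mu w)) => //.
by under eq_bigr do rewrite scalerBl; rewrite sumrB eq_lm subrr.
Qed.

(** * Sums over finite sets *)

Lemma sum_fset_delta (K : pzRingType) (V : lmodType K) (I : choiceType)
    (S : {fset I}) (g : I -> V) w : w \in S ->
  \sum_(v <- S) (v == w)%:R *: g v = g w.
Proof.
move=> wS; rewrite (big_fsetD1 w) //= eqxx scale1r big_seq big1 ?addr0 // => v.
by rewrite !inE => /andP[/negPf -> _]; rewrite scale0r.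
Qed.

Lemma extend_along_injection (I J : choiceType) (V : nmodType) (g : I -> J)
    (S : {fset I}) : {in S &, injective g} ->
  forall lam : I -> V, exists mu : J -> V, forall v, v \in S -> mu (g v) = lam v.
Proof.
move=> g_inj lam.
exists (fun w => \sum_(v <- S) (if g v == w then lam v else 0)) => v vS.
rewrite (big_fsetD1 v) //= eqxx big_seq big1 ?addr0 // => w.
rewrite !inE => /andP[wv wS]; case: eqP => // gwv.
by rewrite (g_inj w v wS vS gwv) eqxx in wv.
Qed.

Lemma near_fset (T : Type) (I : choiceType) (A : {fset I}) (Q : I -> T -> Prop)
    (F : set_system T) : Filter F ->
  (forall i, i \in A -> \forall x \near F, Q i x) ->
  \forall x \near F, forall i, i \in A -> Q i x.
Proof. by move=> FF AQ; exact: (@filter_bigI _ _ A Q F FF AQ). Qed.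

Lemma sum_fpowersetU1 (I : choiceType) (V : nmodType) (C : {fset I}) v
    (F : {fset I} -> V) : v \notin C ->
  \sum_(S <- fpowerset (v |` C)%fset) F S =
  \sum_(S <- fpowerset C) F S + \sum_(S <- fpowerset C) F (v |` S)%fset.
Proof.
move=> vC; have vS S : (S `<=` C)%fset -> v \notin S.
  by move=> sub; apply: contra vC; apply: (fsubsetP sub).
rewrite (big_fsetID _ (fun S : {fset I} => v \notin S)) /=; congr (_ + _).
  apply: eq_fbigl => S; rewrite !inE /= !fpowersetE.
  apply/andP/idP => [[sub vS']|sub]; last first.
    by rewrite (fsubset_trans sub (fsubsetU1 _ _)) vS.
  by move: sub; rewrite -fsubDset mem_fsetD1.
transitivity (\sum_(S <- [fset (v |` S)%fset | S in fpowerset C]%fset) F S); last first.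
  rewrite big_imfset // => S S'; rewrite !fpowersetE => /vS vS1 /vS vS2 eqS.
  by rewrite -(fsetU1K vS1) eqS fsetU1K.
apply: eq_fbigl => S; rewrite !inE /= negbK fpowersetE.
apply/andP/imfsetP => [[sub vS']|[S' /= + ->]]; last first.
  by rewrite fpowersetE => sub; rewrite fset1U1 fsetUS.
by exists (S `\ v)%fset; rewrite ?fsetD1K //= fpowersetE fsubDset.
Qed.

Lemma sum_fpowersetU1_prod (K : comPzRingType) (I : choiceType) (C : {fset I}) v
    (F : {fset I} -> K) (a b : I -> K) : v \notin C ->
  \sum_(S <- fpowerset (v |` C)%fset)
    F S * \prod_(w <- (v |` C)%fset) (if w \in S then a w else b w) =
  a v * (\sum_(S <- fpowerset C)
    F (v |` S)%fset * \prod_(w <- C) (if w \in S then a w else b w)) +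
  b v * (\sum_(S <- fpowerset C)
    F S * \prod_(w <- C) (if w \in S then a w else b w)).
Proof.
move=> vC; rewrite sum_fpowersetU1 // addrC !mulr_sumr; congr (_ + _).
  apply: eq_bigr => S _; rewrite big_fsetU1 //= fset1U1 mulrCA; congr (_ * (_ * _)).
  apply: eq_big_seq => w wC; rewrite !inE; have [wv|//] := eqVneq w v.
  by rewrite wv (negPf vC) in wC.
apply: eq_big_seq => S; rewrite fpowersetE => /fsubsetP sub.
by rewrite big_fsetU1 //= (negPf (contra (sub v) vC)) mulrCA.
Qed.

Lemma mem_imfset_inj_in (I J : choiceType) (C S : {fset I}) (g : I -> J) v :
  {in C &, injective g} -> (S `<=` C)%fset -> v \in C ->
  (g v \in [fset g w | w in S]%fset) = (v \in S).
Proof.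
move=> g_inj /fsubsetP sub vC; apply/imfsetP/idP => [[w /= wS]|vS]; last by exists v.
by move/(g_inj v w vC (sub w wS)) ->.
Qed.

Lemma sum_fpowerset_imfset (I J : choiceType) (V : nmodType) (C : {fset I})
    (g : I -> J) (F : {fset J} -> V) : {in C &, injective g} ->
  \sum_(S <- fpowerset [fset g v | v in C]%fset) F S =
  \sum_(S <- fpowerset C) F [fset g v | v in S]%fset.
Proof.
move=> g_inj; transitivity
    (\sum_(S <- [fset [fset g v | v in S]%fset | S : {fset I} in fpowerset C]%fset) F S).
  apply: eq_fbigl => S; rewrite fpowersetE; apply/idP/imfsetP => [/fsubsetP sub|].
    exists [fset v in C | g v \in S]%fset.
      by rewrite /= fpowersetE; exact: fset_sub.
    apply/fsetP => w; apply/idP/imfsetP => [wS|[v /=]]; last first.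
      by rewrite !inE => /andP[_ gvS] ->.
    by have /imfsetP[v /= vC wE] := sub w wS; exists v; rewrite //= !inE vC -wE.
  by move=> [S' /=]; rewrite fpowersetE => sub ->; apply: subset_imfset; apply/fsubsetP.
rewrite big_imfset // => S S'; rewrite !fpowersetE => sub sub' eqS; apply/fsetP => v.
have [vC|vC] := boolP (v \in C); first by rewrite -!(mem_imfset_inj_in g_inj _ vC) // eqS.
by rewrite (contraNF (fsubsetP sub v) vC) (contraNF (fsubsetP sub' v) vC).
Qed.

Lemma prod_fset_if (K : comPzRingType) (I : choiceType) (C S : {fset I}) (a b : K) :
  (S `<=` C)%fset ->
  \prod_(w <- C) (if w \in S then a else b) = a ^+ #|` S| * b ^+ (#|` C| - #|` S|).
Proof.
move=> sub; rewrite (big_fsetID _ (mem S)) /=; congr (_ * _).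
  transitivity (\prod_(w <- S) a); last by rewrite big_const_seq count_predT iter_mulr_1.
  rewrite (@eq_fbigl _ _ _ _ _ S) => [|w]; first by apply: eq_big_seq => w ->.
  by rewrite !inE /= andbC; case: (boolP (w \in S)) => // /(fsubsetP sub) ->.
transitivity (\prod_(w <- (C `\` S)%fset) b).
  rewrite (@eq_fbigl _ _ _ _ _ (C `\` S)%fset) => [|w]; last by rewrite !inE /= andbC.
  by apply: eq_big_seq => w; rewrite inE => /andP[/negPf ->].
by rewrite big_const_seq count_predT iter_mulr_1 cardfsDS.
Qed.

(** * Compact convex sets and their polars *)

Section ConvexHull.
Variables (R : realType) (d : nat).
Implicit Types (x y p f : 'rV[R]_d) (A : {fset 'rV[R]_d}) (P : set 'rV[R]_d).

Lemma convex_setP P : convex_set P <->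
  forall x y (r : R), 0 <= r <= 1 -> P x -> P y -> P (r *: x + (1 - r) *: y).
Proof.
split=> [cP x y r /andP[r0 r1] Px Py|cP x y r].
  by have := cP x y (Itv01 r0 r1) (mem_set Px) (mem_set Py); rewrite inE.
rewrite !inE => Px Py; apply: (cP x y r%:num) => //.
by rewrite ge0 le1.
Qed.

Lemma conv_gen A a : a \in A -> conv A a.
Proof.
move=> aA; exists (fun b => (b == a)%:R); split.
- by move=> b _; case: eqP.
- rewrite -[RHS](sum_fset_delta (fun=> 1 : R^o) aA); apply: eq_bigr => b _.
  by rewrite [RHS]mulr1.
- by rewrite (sum_fset_delta id aA).
Qed.

Lemma conv_convex A : convex_set (conv A).
Proof.
apply/convex_setP => x y r /andP[r0 r1] [lam [lam_ge0 lam_sum1 ->]] [mu [mu_ge0 mu_sum1 ->]].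
exists (fun a => r * lam a + (1 - r) * mu a); split.
- by move=> a aA; rewrite addr_ge0 ?mulr_ge0 ?lam_ge0 ?mu_ge0 // subr_ge0.
- by rewrite big_split /= -!mulr_sumr lam_sum1 mu_sum1; ring.
- rewrite !scaler_sumr -big_split /=; apply: eq_bigr => a _.
  by rewrite !scalerA -scalerDl.
Qed.

Lemma conv_dot_le A f t : (forall a, a \in A -> dot a f <= t) ->
  forall x, conv A x -> dot x f <= t.
Proof.
move=> ft x [lam [lam_ge0 lam_sum1 ->]]; rewrite dot_suml.
rewrite -[t]mul1r -lam_sum1 mulr_suml !big_seq; apply: ler_sum => a aA.
by rewrite ler_wpM2l ?lam_ge0 ?ft.
Qed.

Lemma conv_dot_attained A x f : conv A x ->
  (forall a, a \in A -> dot a f <= dot x f) ->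
  exists2 a, a \in A & dot a f = dot x f.
Proof.
move=> [lam [lam_ge0 lam_sum1 xE]] le_x; apply: contrapT => noA.
have lam_eq0 a : a \in A -> lam a = 0.
  move=> aA; have : \sum_(b <- A) lam b * (dot x f - dot b f) == 0.
    under eq_bigr do rewrite mulrBr.
    by rewrite sumrB -mulr_suml lam_sum1 mul1r -dot_suml -xE subrr.
  rewrite big_seq psumr_eq0; last by move=> b bA; rewrite mulr_ge0 ?lam_ge0 // subr_ge0 le_x.
  move=> /allP/(_ a aA); rewrite aA mulf_eq0 subr_eq0 => /orP[/eqP//|/eqP fa].
  by case: noA; exists a.
by move: lam_sum1 => /eqP; rewrite big_seq big1 ?[0 == 1]eq_sym ?oner_eq0.
Qed.

Definition prob_simplex n : set 'rV[R]_n :=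
  [set l | (forall i, 0 <= l 0 i) /\ \sum_i l 0 i = 1].

Lemma prob_simplex_compact n : compact (@prob_simplex n).
Proof.
have -> : @prob_simplex n = [set l : 'rV[R]_n | forall i, `[0, 1]%classic (l 0 i)] `&`
    (fun l => \sum_i l 0 i) @^-1` [set 1].
  apply/seteqP; split=> l [l_ge0 l_sum1]; split=> // i; last first.
    by have := l_ge0 i; rewrite /= in_itv /= => /andP[].
  by rewrite /= in_itv /= l_ge0 -l_sum1 (bigD1 i) //= lerDl sumr_ge0.
apply: compact_closedI.
  by apply: (@rV_compact R n (fun=> `[0, 1]%classic)) => _; exact: segment_compact.
apply: preimage_closed; last exact: closed_eq.
by move=> l _; apply: (@continuous_sum _ R^o) => i; exact: coord_continuous.
Qed.

Lemma conv_prob_simplex A :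
  conv A = mulmxr (family_mx A id) @` @prob_simplex #|{: A}|.
Proof.
apply/seteqP; split=> [_ [lam [l_ge0 l_sum1 ->]]|_ [l [l_ge0 l_sum1] <-]].
  exists (coord_row A lam); last by rewrite /= coord_row_mul.
  split; first by move=> i; rewrite mxE l_ge0 ?fsvalP.
  by rewrite -l_sum1 -sum_enum_val; apply: eq_bigr => i _; rewrite mxE.
have [lam lE] := coord_row_surj l; subst l; exists lam; split.
- by move=> v vA; have := l_ge0 (enum_rank [` vA]%fset); rewrite mxE enum_rankK.
- by rewrite -[RHS]l_sum1 -sum_enum_val; apply: eq_bigr => i _; rewrite mxE.
- by rewrite /= coord_row_mul.
Qed.

Lemma conv_compact A : compact (conv A).
Proof.
rewrite conv_prob_simplex; apply: continuous_compact; last exact: prob_simplex_compact.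
apply: continuous_subspaceT => l; rewrite /mulmxr; under eq_fun do rewrite mulmx_sum_row.
by apply: continuous_sum => i {}l; apply: continuousZr_tmp; exact: coord_continuous.
Qed.

End ConvexHull.

Section Separation.
Variables (R : realType) (d : nat).
Implicit Types (x y p f : 'rV[R]_d) (P : set 'rV[R]_d).

Let dist2_continuous x : continuous (fun p => dot (x - p) (x - p)).
Proof.
apply: (@continuous_sum _ R^o _ _ _ (fun i p => (x - p) 0 i * (x - p) 0 i)) => i.
have coordB : continuous (fun p => (x - p) 0 i).
  by move=> p; under eq_fun do rewrite !mxE; apply: continuousB;
    [exact: cst_continuous|exact: coord_continuous].
by move=> p; apply: continuousM; exact: coordB.
Qed.

(* The functional is [x - c], where [c] is the point of [P] nearest to [x]. *)
Lemma convex_compact_separation P x : compact P -> convex_set P -> ~ P x ->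
  exists f t, (forall p, P p -> dot p f <= t) /\ t < dot x f.
Proof.
move=> compactP /convex_setP convexP xNP; have [[p0 Pp0]|noP] := pselect (P !=set0); last first.
  by exists 0, (-1); split=> [p Pp|]; [case: noP; exists p|rewrite dot0r ltrN10].
have [||c /set_mem Pc c_min] := @EVT_min_rV _ _ (fun p => dot (x - p) (x - p)) P _ compactP.
- by exists p0.
- exact/continuous_subspaceT/dist2_continuous.
exists (x - c), (dot c (x - c)); split; last first.
  rewrite -subr_gt0 -dotBl dot_gt0 subr_eq0.
  by apply: contra_notN xNP => /eqP ->.
move=> p Pp; rewrite -subr_le0 -dotBl leNgt; apply/negP.
set w := p - c; set f := x - c; set k := dot w f => k_gt0.
have ww_ge0 : 0 <= dot w w by apply: sumr_ge0 => i _; rewrite -expr2 sqr_ge0.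
have kww_gt0 : 0 < k + dot w w by rewrite ltr_pwDl.
pose r := k / (k + dot w w).
have r_gt0 : 0 < r by rewrite divr_gt0.
have r_le1 : r <= 1 by rewrite ler_pdivrMr // mul1r lerDl.
have : dot f f <= dot (x - (r *: p + (1 - r) *: c)) (x - (r *: p + (1 - r) *: c)).
  by apply/c_min/mem_set/convexP => //; rewrite ltW.
have -> : x - (r *: p + (1 - r) *: c) = f - r *: w.
  by apply/rowP => i; rewrite !mxE; ring.
rewrite dot_sqrBZ -/k => le_ff.
have : r * (k + dot w w) = k by rewrite /r divfK // gt_eqF.
nra.
Qed.

End Separation.

Lemma dual0 (R : realType) d (P : set 'rV[R]_d) : dual P 0.
Proof. by move=> x _; rewrite -/(dot x 0) dot0r ler01. Qed.

Section Polar.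
Variables (R : realType) (d : nat) (P : set 'rV[R]_d).
Hypothesis compactP : compact P.
Hypothesis convexP : convex_set P.
Hypothesis P0 : interior P 0.
Implicit Types x y c v : 'rV[R]_d.

Lemma interior_line Q x v : interior Q x -> \forall e \near (0 : R)^'+, Q (x + e *: v).
Proof.
move=> Qx; have : x + e *: v @[e --> (0 : R)] --> x + 0 *: v.
  by apply: cvgD; [exact: cvg_cst|exact: scalel_continuous].
by rewrite scale0r addr0 => /cvg_at_right_filter/(_ _ Qx).
Qed.

Lemma convex_shrink_interior x r : 0 <= r < 1 -> P x -> interior P (r *: x).
Proof.
move=> /andP[r_ge0 r_lt1] Px; have r_lt1' : 0 < 1 - r by rewrite subr_gt0.
have : \forall y \near r *: x, P ((1 - r)^-1 *: (y - r *: x)).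
  have : continuous_at (r *: x) (fun y : 'rV[R]_d => (1 - r)^-1 *: (y - r *: x)).
    apply: (@continuousZl_tmp _ _ _ (fun y : 'rV[R]_d => y - r *: x)); apply: continuousB.
      exact: cvg_id.
    exact: cst_continuous.
  by apply; rewrite subrr scaler0.
rewrite /interior; apply: filterS => y Py.
have -> : y = r *: x + (1 - r) *: ((1 - r)^-1 *: (y - r *: x)).
  by rewrite scalerA mulfV ?gt_eqF // scale1r addrC subrK.
by move/convex_setP: convexP; apply => //; rewrite r_ge0 ltW.
Qed.

Lemma dual_compact : compact (dual P).
Proof.
have dualE : dual P = \bigcap_(x in P) [set y | dot x y <= 1] by [].
apply: bounded_closed_compact; last first.
  rewrite dualE; apply: closed_bigI => x _.
  apply: (@preimage_closed _ _ (dot x) [set r | r <= 1]); last exact: closed_le.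
  by move=> y _; exact: dot_continuous.
near (0 : R)^'+ => e.
have e_gt0 : 0 < e by near: e; exact: nbhs_right_gt.
have e_pos : forall i, P (0 + e *: delta_mx 0 i).
  by near: e; apply: filter_forall => i; exact: interior_line.
have e_neg : forall i, P (0 + e *: - delta_mx 0 i).
  by near: e; apply: filter_forall => i; exact: interior_line.
exists e^-1; split; first exact: num_real.
move=> M eM y Py; change (mx_norm y <= M); rewrite mx_normrE; apply/bigmax_leP; split.
  by apply: ltW; apply: lt_trans eM; rewrite invr_gt0.
move=> [i0 i] _ /=; rewrite ord1; apply: le_trans (ltW eM).
have := Py _ (e_pos i); have := Py _ (e_neg i).
rewrite -!/(dot _ y) !add0r scalerN -!scaleNr !dotZl dot_delta => le_neg le_pos.
by rewrite -(ler_pM2l e_gt0) mulfV ?gt_eqF // -(gtr0_norm e_gt0) -normrM ler_norml; lra.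
Unshelve. all: by end_near. Qed.

Lemma bidual x : (forall y, dual P y -> dot x y <= 1) -> P x.
Proof.
move=> xP; apply: contrapT => /(convex_compact_separation compactP convexP)[f [t [ft tx]]].
have t_ge0 : 0 <= t by have := ft 0 (interior_subset P0); rewrite dotC dot0r.
pose s := (t + dot x f) / 2; have s_gt0 : 0 < s by rewrite /s; lra.
have : dot x (s^-1 *: f) <= 1.
  apply: xP => z Pz; rewrite -/(dot z _) dotZr mulrC ler_pdivrMr // mul1r.
  by have := ft z Pz; rewrite /s; lra.
by rewrite dotZr mulrC ler_pdivrMr // mul1r /s; lra.
Qed.

Lemma dual_attains_max x : exists2 y, dual P y & forall y', dual P y' -> dot x y' <= dot x y.
Proof.
have [|y /set_mem Py y_max] := EVT_max_rV _ dual_compact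
    (continuous_subspaceT (@dot_continuous _ _ x)).
  by exists 0; exact: dual0.
by exists y => // y' /mem_set/y_max.
Qed.

Lemma boundaryP c :
  boundary P c <-> P c /\ exists2 y, dual P y & dot c y = 1.
Proof.
have closedP := compact_closed (@norm_hausdorff _ _) compactP.
split=> [[/closedP Pc cNi]|[Pc [y Py cy]]]; last first.
  split; first exact: subset_closure.
  move=> intPc; near (0 : R)^'+ => e; have e_gt0 : 0 < e by near: e; exact: nbhs_right_gt.
  have /Py : P (c + e *: c) by near: e; exact: interior_line.
  by rewrite -/(dot _ y) dotDl dotZl cy; lra.
split=> //; have [y Py y_max] := dual_attains_max c; exists y => //.
apply: le_anti; rewrite Py //= leNgt; apply/negP => cy1; apply: cNi.
pose t := Num.max (dot c y) (1 / 2).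
have t_gt0 : 0 < t by rewrite lt_max; apply/orP; right; lra.
have -> : c = t *: (t^-1 *: c) by rewrite scalerA mulfV ?gt_eqF // scale1r.
apply: convex_shrink_interior; first by rewrite ltW //= gt_max cy1 /=; lra.
apply: bidual => y' /y_max cy'; rewrite dotZl mulrC.
by rewrite ler_pdivrMr // mul1r le_max cy'.
Unshelve. all: by end_near. Qed.

Lemma boundary_ray x : x != 0 -> exists2 s : R, 0 < s & boundary P (s *: x).
Proof.
move=> x_neq0; have [|p /set_mem Pp p_max] := EVT_max_rV _ compactP
    (continuous_subspaceT (@dot_continuous _ _ x)).
  by exists 0; exact: interior_subset.
have px_gt0 : 0 < dot p x.
  near (0 : R)^'+ => e; have e_gt0 : 0 < e by near: e; exact: nbhs_right_gt.
  have /mem_set/p_max : P (0 + e *: x) by near: e; exact: interior_line.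
  by rewrite add0r dotZr (dotC x p); apply: lt_le_trans; rewrite mulr_gt0 ?dot_gt0.
have [y Py y_max] := dual_attains_max x.
have xy_gt0 : 0 < dot x y.
  have /y_max : dual P ((dot p x)^-1 *: x).
    move=> z /mem_set/p_max; rewrite -/(dot z _) dotZr mulrC ler_pdivrMr // mul1r.
    by rewrite dotC (dotC x).
  by apply: lt_le_trans; rewrite dotZr mulr_gt0 ?invr_gt0 ?dot_gt0.
exists (dot x y)^-1; first by rewrite invr_gt0.
apply/boundaryP; split.
  apply: bidual => y' /y_max xy'.
  by rewrite dotZl mulrC ler_pdivrMr // mul1r.
by exists y => //; rewrite dotZl mulVf ?gt_eqF.
Unshelve. all: by end_near. Qed.

End Polar.

(** * Rational generating functions *)

Local Notation "x %:F" := (tofrac x).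

Section GeneratingFunctions.
Variable K : fieldType.
Implicit Types (D E N p : {poly K}) (f g : nat -> K) (F G : {fraction {poly K}}).

Definition cauchy D f (n : nat) : K := \sum_(k < n.+1) D`_k * f (n - k)%N.

Lemma cauchy_coef D p n : cauchy D (fun i => p`_i) n = (D * p)`_n.
Proof. by rewrite coefM. Qed.

Lemma eq_cauchy D f g : f =1 g -> cauchy D f =1 cauchy D g.
Proof. by move=> fg n; apply: eq_bigr => k _; rewrite fg. Qed.

Lemma cauchy_trunc D f m n : (n < m)%N -> cauchy D f n = (D * \poly_(i < m) f i)`_n.
Proof.
move=> nm; rewrite coefM; apply: eq_bigr => k _; rewrite coef_poly.
by rewrite (leq_ltn_trans _ nm) // leq_subr.
Qed.

Lemma cauchyM D E f : cauchy (D * E) f =1 cauchy D (cauchy E f).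
Proof.
move=> n; rewrite (cauchy_trunc _ _ (ltnSn n)) -mulrA coefM; apply: eq_bigr => k _.
by rewrite (@cauchy_trunc _ _ n.+1) // ltnS leq_subr.
Qed.

Lemma cauchyBl D E f n : cauchy (D - E) f n = cauchy D f n - cauchy E f n.
Proof. by rewrite -sumrB; apply: eq_bigr => k _; rewrite coefB mulrBl. Qed.

Lemma cauchyDr D f g n :
  cauchy D (fun i => f i + g i) n = cauchy D f n + cauchy D g n.
Proof. by rewrite -big_split; apply: eq_bigr => k _; rewrite mulrDr. Qed.

Lemma cauchy_Xn q f n : cauchy 'X^q f n = if (q <= n)%N then f (n - q)%N else 0.
Proof.
rewrite (cauchy_trunc _ _ (ltnSn n)) coefXnM coef_poly ltnS leq_subr.
by case: ltnP.
Qed.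

Lemma cauchy1 f : cauchy 1 f =1 f.
Proof. by move=> n; rewrite -(expr0 'X) cauchy_Xn subn0. Qed.

Lemma cauchy_inj D f g : D`_0 != 0 -> cauchy D f =1 cauchy D g -> f =1 g.
Proof.
move=> D0 fg n; elim/ltn_ind: n => n IH.
have := fg n; rewrite /cauchy !big_ord_recl subn0 /= => eqn.
apply/(mulfI D0)/(addIr (\sum_(i < n) D`_(bump 0 i) * f (n - bump 0 i)%N)).
rewrite eqn; congr (_ + _); apply: eq_bigr => i _; rewrite IH //.
by rewrite /bump /= ltn_subrL /= (leq_ltn_trans _ (ltn_ord i)).
Qed.

Definition genfun f F := exists N D,
  [/\ D`_0 != 0, D%:F * F = N%:F & forall n, cauchy D f n = N`_n].

Lemma coef0_neq0 D : D`_0 != 0 -> D%:F != 0.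
Proof. by apply: contraNneq => /eqP; rewrite tofrac_eq0 => /eqP ->; rewrite coef0. Qed.

Lemma coef0M_neq0 D E : D`_0 != 0 -> E`_0 != 0 -> (D * E)`_0 != 0.
Proof. by move=> D0 E0; rewrite coefM big_ord1 mulf_neq0. Qed.

Lemma genfun_ext f g F : f =1 g -> genfun f F -> genfun g F.
Proof.
move=> fg [N [D [D0 DF Df]]]; exists N, D; split=> // n.
by rewrite -Df; apply/esym/eq_cauchy.
Qed.

Lemma genfun_poly p : genfun (fun n => p`_n) p%:F.
Proof.
exists p, 1; split; [by rewrite coef1 oner_neq0|by rewrite tofrac1 mul1r|].
by move=> n; rewrite cauchy1.
Qed.

Lemma genfun_cauchy p f F : genfun f F -> genfun (cauchy p f) (p%:F * F).
Proof.
move=> [N [D [D0 DF Df]]]; exists (p * N), D; split=> //.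
  by rewrite mulrCA DF tofracM.
by move=> n; rewrite -cauchyM mulrC cauchyM -cauchy_coef; apply: eq_cauchy.
Qed.

Lemma genfunD f g F G : genfun f F -> genfun g G ->
  genfun (fun n => f n + g n) (F + G).
Proof.
move=> [N [D [D0 DF Df]]] [M [E [E0 EG Eg]]].
exists (E * N + D * M), (D * E); split; first exact: coef0M_neq0.
  by rewrite tofracD !tofracM mulrDr -DF -EG; ring.
move=> n; rewrite cauchyDr coefD; congr (_ + _).
  by rewrite mulrC cauchyM -cauchy_coef; apply: eq_cauchy.
by rewrite cauchyM -cauchy_coef; apply: eq_cauchy.
Qed.

Lemma genfun_sum (I : eqType) (s : seq I) (f : I -> nat -> K)
    (F : I -> {fraction {poly K}}) : (forall i, i \in s -> genfun (f i) (F i)) ->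
  genfun (fun n => \sum_(i <- s) f i n) (\sum_(i <- s) F i).
Proof.
elim: s => [|i s IH] fF.
  rewrite big_nil -tofrac0; apply: genfun_ext (genfun_poly 0) => n.
  by rewrite coef0 big_nil.
rewrite big_cons; apply: genfun_ext (genfunD (fF i (mem_head _ _)) (IH _)).
  by move=> n; rewrite big_cons.
by move=> j js; apply: fF; rewrite inE js orbT.
Qed.

Lemma genfun_div p f G : p`_0 != 0 -> genfun (cauchy p f) G -> genfun f (G / p%:F).
Proof.
move=> p0 [N [D [D0 DG Df]]]; exists N, (D * p); split; first exact: coef0M_neq0.
  by rewrite tofracM mulrACA mulfV ?mulr1 ?coef0_neq0.
by move=> n; rewrite cauchyM.
Qed.

Lemma coef0_1subXn q : (0 < q)%N -> (1 - 'X^q : {poly K})`_0 != 0.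
Proof. by case: q => // q _; rewrite coefB coef1 coefXn subr0 oner_neq0. Qed.

Lemma genfun_geometric q f g G : (0 < q)%N ->
  (forall n, f n = g n + cauchy 'X^q f n) -> genfun g G ->
  genfun f (G / (1 - 'X%:F ^+ q)).
Proof.
move=> q0 fE gG; rewrite -tofracXn -tofrac1 -tofracB.
apply: genfun_div; first exact: coef0_1subXn.
by apply: genfun_ext gG => n; rewrite cauchyBl cauchy1 fE addrK.
Qed.

Lemma genfun_polyP f p : genfun f p%:F -> forall n, f n = p`_n.
Proof.
move=> [N [D [D0 DF Df]]]; apply: (cauchy_inj D0) => n.
by rewrite Df cauchy_coef; move/eqP: DF; rewrite -tofracM tofrac_eq => /eqP ->.
Qed.

Lemma genfun_unique f F G : genfun f F -> genfun f G -> F = G.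
Proof.
move=> [N [D [D0 DF Df]]] [M [E [E0 EG Ef]]].
apply: (mulfI (coef0_neq0 (coef0M_neq0 D0 E0))).
rewrite tofracM {1}[D%:F * _]mulrC -!mulrA DF EG -!tofracM; congr tofrac.
apply/polyP => n; rewrite -!cauchy_coef -(eq_cauchy _ Df) -(eq_cauchy _ Ef).
by rewrite -!cauchyM mulrC.
Qed.

Lemma genfun_eq0 f F : genfun f F -> F = 0 <-> forall n, f n = 0.
Proof.
move=> fF; split=> [F0 n|f0].
  by rewrite (@genfun_polyP f 0) ?coef0 // tofrac0 -F0.
apply: genfun_unique fF _; rewrite -tofrac0; apply: genfun_ext (genfun_poly 0) => n.
by rewrite f0 coef0.
Qed.

End GeneratingFunctions.

(** * Integer points counted by their last coordinate *)

Fact int_to_real_is_additive (R : realType) d : zmod_morphism (@int_to_real R d).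
Proof. exact: raddfB. Qed.

HB.instance Definition _ (R : realType) d := GRing.isZmodMorphism.Build
  'rV[int]_d 'rV[R]_d (@int_to_real R d) (@int_to_real_is_additive R d).

Lemma finite_bounded_rows k (b : nat) :
  finite_set [set v : 'rV[int]_k | forall i, `|v 0 i| <= b%:Z].
Proof.
pose g (f : {ffun 'I_k -> 'I_(b + b).+1}) : 'rV[int]_k := \row_i ((f i)%:Z - b%:Z).
apply: (@sub_finite_set _ _ (g @` [set: _])); last exact/finite_image/finite_finset.
move=> v /= vb; exists [ffun i => inord (absz (v 0 i + b%:Z))] => //.
apply/rowP => i; rewrite !mxE ffunE; have := vb i; rewrite ler_norml => /andP[lb ub].
have abs_vb : (absz (v 0 i + b%:Z))%:Z = v 0 i + b%:Z by lia.
by rewrite inordK ?abs_vb ?addrK //; lia.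
Qed.

Section LevelCount.
Local Notation z := ('X%:F : ratfun).
Variable d : nat.
Implicit Types (S X : set 'rV[int]_(d + 1)) (v w : 'rV[int]_(d + 1)).
Implicit Types F G : ratfun.

Definition level (n : nat) : set 'rV[int]_(d + 1) := [set v | u v = n%:Z].

Definition level_count S (n : nat) : rat := (#|` fset_set (S `&` level n)|)%:R.

Definition level_finite S := forall n, finite_set (S `&` level n).

Fact u_is_additive : zmod_morphism (@u d).
Proof. by move=> v w; rewrite /u !mxE. Qed.

HB.instance Definition _ :=
  GRing.isZmodMorphism.Build 'rV[int]_(d + 1) int (@u d) u_is_additive.

Lemma level_count_set0 n : level_count set0 n = 0.
Proof. by rewrite /level_count set0I fset_set0 cardfs0. Qed.

Lemma level_countU S X n : level_finite S -> level_finite X -> S `&` X = set0 ->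
  level_count (S `|` X) n = level_count S n + level_count X n.
Proof.
move=> fS fX SX; rewrite /level_count setIUl fset_setU // -natrD -cardfsUI.
by rewrite -fset_setI // setIACA SX set0I fset_set0 cardfs0 addn0.
Qed.

Lemma level_finite_bigcup (I : eqType) (s : seq I) (S : I -> set 'rV[int]_(d + 1)) :
  (forall i, i \in s -> level_finite (S i)) ->
  level_finite (\bigcup_(i in [set` s]) S i).
Proof.
move=> fS n; rewrite setI_bigcupl; apply: bigcup_finite; first exact: finite_seq.
by move=> j /= js; apply: fS.
Qed.

Lemma level_count_bigcup (I : choiceType) (s : seq I)
    (S : I -> set 'rV[int]_(d + 1)) n : uniq s ->
  (forall i, i \in s -> level_finite (S i)) -> trivIset [set` s] S ->
  level_count (\bigcup_(i in [set` s]) S i) n = \sum_(i <- s) level_count (S i) n.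
Proof.
elim: s => [|i s IH] us fS disjS.
  by rewrite set_nil bigcup_set0 level_count_set0 big_nil.
have [iNs {}us] := andP us; have sub_s : [set` s] `<=` [set` i :: s].
  by move=> j /= js; rewrite inE js orbT.
rewrite bigcup_seq !big_cons -bigcup_seq level_countU.
- by rewrite IH // => [j js|]; [apply/fS/sub_s|exact: sub_trivIset disjS].
- by apply: fS; rewrite mem_head.
- by apply: level_finite_bigcup => j js; apply/fS/sub_s.
rewrite setI_bigcupr; apply: bigcup0 => j js.
apply: (classical_sets.trivIsetP.1 disjS); rewrite /= ?mem_head //; first exact: sub_s.
by apply: contraNneq iNs => ->.
Qed.

Lemma level_count_translate w q S n : u w = q%:Z -> (forall v, S v -> 0 <= u v) ->
  level_finite S ->
  level_count [set v + w | v in S] n = cauchy 'X^q (level_count S) n.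
Proof.
move=> uw S0 fS; rewrite cauchy_Xn; case: leqP => qn; last first.
  rewrite /level_count (_ : _ `&` _ = set0) ?fset_set0 ?cardfs0 //.
  apply/seteqP; split=> // _ [[v Sv <-]]; rewrite /level /= raddfD /= uw => uv.
  by have := S0 v Sv; lia.
rewrite /level_count (_ : _ `&` _ = [set v + w | v in S `&` level (n - q)%N]).
  by rewrite fset_set_image // card_imfset //; apply: addIr.
apply/seteqP; split=> [_ [[v Sv <-]]|_ [v [Sv uv] <-]].
  rewrite /level /= raddfD /= uw => uv; exists v => //; split=> //=; lia.
by split; [exists v|rewrite /level /= raddfD /= uw uv; lia].
Qed.

Lemma level_count_eq0 S : level_finite S -> (forall v, S v -> 0 <= u v) ->
  (forall n, level_count S n = 0) <-> S = set0.
Proof.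
move=> fS S0; split=> [count0|-> n]; last exact: level_count_set0.
apply/seteqP; split=> v // Sv; have /eqP := count0 (absz (u v)).
rewrite pnatr_eq0 cardfs_eq0 => /eqP/(fset_set_set0 (fS _)) empty.
by rewrite -empty; split; rewrite // /level /= gez0_abs ?S0.
Qed.

Lemma sum_level_poly S : finite_set S -> (forall v, S v -> 0 <= u v) ->
  \sum_(v \in S) z ^ u v =
  (\sum_(v <- fset_set S) 'X^(absz (u v)))%:F.
Proof.
move=> fS S0; rewrite fsbig_finite //= rmorph_sum /=; apply: eq_big_seq => v.
rewrite in_fset_set // inE => Sv; rewrite tofracXn.
by rewrite -{1}(gez0_abs (S0 v Sv)).
Qed.

Lemma genfun_level_count S : finite_set S -> (forall v, S v -> 0 <= u v) ->
  genfun (level_count S) (\sum_(v \in S) z ^ u v).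
Proof.
move=> fS S0; rewrite sum_level_poly //.
apply: genfun_ext (genfun_poly _) => n; rewrite coef_sum /level_count.
under eq_bigr do rewrite coefXn.
rewrite -natr_sum -big_mkcond /= sum1_count; congr (_%:R).
have -> : fset_set (S `&` level n) = [fset v in fset_set S | n == absz (u v)]%fset.
  apply/fsetP => v; have fSn : finite_set (S `&` level n).
    by apply: sub_finite_set fS => w [].
  rewrite in_fset_set // in_fset /= !inE /= in_fset_set //.
  apply/idP/andP => [|[]]; rewrite !inE.
    by move=> [Sv uv]; split=> //; rewrite uv.
  by move=> Sv /eqP nE; split=> //; rewrite /level /= nE gez0_abs // S0.
rewrite -sum1_count -sum1_size -[RHS]/(\sum_(v <- [fset v in _ | _]%fset) 1)%N.
by rewrite big_fset.
Qed.

End LevelCount.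

(** * Integer points with constrained coordinates *)

Section HalfLines.
Variable R : realType.

Definition nneg_half : set R := [set x | 0 <= x].
Definition pos_half : set R := [set x | 0 < x].
Definition unit_open : set R := [set x | 0 < x < 1].
Definition nneg_nonint : set R := [set x | 0 <= x /\ x \isn't a Num.int].

Lemma unit_open_nneg : unit_open `<=` nneg_half.
Proof. by move=> x /andP[/ltW]. Qed.

Lemma set0_nneg : [set 0] `<=` nneg_half.
Proof. by move=> x ->; rewrite /nneg_half /=. Qed.

Lemma nneg_nonint_nneg : nneg_nonint `<=` nneg_half.
Proof. by move=> x []. Qed.

Lemma pos_half_periodic : pos_half =
  ([set x + 1 | x in [set 0]] `|` unit_open) `|` [set x + 1 | x in pos_half].
Proof.
rewrite image_set1 add0r; apply/seteqP; split=> x; rewrite /pos_half /unit_open /=.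
  by move=> x0; have [x1|x1|->] := ltgtP x 1; [left; right; rewrite x0|
    right; exists (x - 1); lra|left; left].
by case=> [[->//|/andP[]//]|[y y0 <-]]; lra.
Qed.

Lemma nneg_half_periodic : nneg_half =
  ([set 0] `|` unit_open) `|` [set x + 1 | x in nneg_half].
Proof.
apply/seteqP; split=> x; rewrite /nneg_half /unit_open /=.
  move=> x0; have [x1|x1] := ltP x 1; last by right; exists (x - 1); lra.
  left; move: x0; rewrite le_eqVlt => /orP[/eqP <-|x0]; first by left.
  by right; rewrite x0.
by case=> [[->//|/andP[/ltW]//]|[y y0 <-]]; lra.
Qed.

Lemma nneg_nonint_periodic :
  nneg_nonint = unit_open `|` [set x + 1 | x in nneg_nonint].
Proof.
apply/seteqP; split=> x; rewrite /nneg_nonint /unit_open /=.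
  move=> [x0 xN]; have [x1|x1] := ltP x 1; last first.
    by right; exists (x - 1); [split; [lra|rewrite rpredBr ?rpred1]|rewrite subrK].
  left; apply/andP; split=> //; rewrite lt_def x0 andbT.
  by apply: contraNneq xN => ->; exact: rpred0.
case=> [/andP[x0 x1]|[y [y0 yN] <-]]; last by split; [lra|rewrite rpredDr ?rpred1].
split; first exact: ltW.
apply/negP => /intrP[m mE]; move: x0 x1; rewrite mE ltr0z -[1]/(1%:~R) ltr_int; lia.
Qed.

End HalfLines.

Arguments nneg_half : clear implicits.
Arguments pos_half : clear implicits.
Arguments unit_open : clear implicits.
Arguments nneg_nonint : clear implicits.

Section ConstrainedCoordinates.
Local Notation z := ('X%:F : ratfun).
Variables (R : realType) (d : nat) (W : {fset 'rV[int]_(d + 1)}).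
Local Notation V := 'rV[int]_(d + 1).
Local Notation ir := (@int_to_real R (d + 1)%N).
Hypothesis W_indep : linearly_independent W ir.
Hypothesis u_gt0 : forall w, w \in W -> 0 < u w.
Implicit Types (S D : {fset V}) (Q : V -> set R) (M U : set R) (v w : V).
Implicit Types (F alpha beta : ratfun).

Definition coordset Q : set V := [set v | exists lam : V -> R,
  (forall w, w \in W -> Q w (lam w)) /\ ir v = \sum_(w <- W) lam w *: ir w].

Definition nneg_coords Q := forall w, w \in W -> Q w `<=` nneg_half R.

Lemma coord_level v (lam : V -> R) : ir v = \sum_(w <- W) lam w *: ir w ->
  (u v)%:~R = \sum_(w <- W) lam w * (u w)%:~R.
Proof.
move=> /rowP/(_ (rshift d ord0)); rewrite mxE => ->; rewrite summxE.
by apply: eq_bigr => w _; rewrite !mxE.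
Qed.

Lemma finite_coordset (n : nat) : finite_set (coordset (fun=> [set x | 0 <= x <= n%:R])).
Proof.
pose b := (n * \sum_(w <- W) \sum_j absz (w 0%R j))%N.
apply: sub_finite_set (finite_bounded_rows (d + 1)%N b).
move=> v [lam [lamQ /rowP vE]] i; rewrite -(ler_int R) intr_norm.
have := vE i; rewrite mxE => ->; rewrite summxE.
apply: le_trans (ler_norm_sum _ _ _) _.
rewrite -[X in _ <= X]/(b%:R) natrM natr_sum.
rewrite mulr_sumr !big_seq; apply: ler_sum => w wW; rewrite !mxE normrM.
have /= /andP[lam_ge0 lam_le_n] := lamQ w wW.
rewrite (ger0_norm lam_ge0) ler_pM // -intr_norm -[X in _ <= X]/((\sum_j absz (w 0%R j))%N%:~R).
rewrite ler_int (bigD1 i) //= PoszD -abszE lerDl; lia.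
Qed.

Lemma coordset_u_ge0 Q : nneg_coords Q -> forall v, coordset Q v -> 0 <= u v.
Proof.
move=> Q0 v [lam [lamQ /coord_level uE]]; rewrite -(ler_int R) uE big_seq.
apply: sumr_ge0 => w wW; apply: mulr_ge0; first exact: (Q0 w wW _ (lamQ w wW)).
by rewrite ler0z ltW ?u_gt0.
Qed.

Lemma coordset_level_finite Q : nneg_coords Q -> level_finite (coordset Q).
Proof.
move=> Q0 n; apply: sub_finite_set (finite_coordset n).
move=> v [[lam [lamQ vE]] uv]; exists lam; split=> // w wW /=.
have lam_ge0 x : x \in W -> 0 <= lam x by move=> xW; exact: (Q0 x xW _ (lamQ x xW)).
rewrite lam_ge0 //=; have := coord_level vE; rewrite uv pmulrn => ->.
rewrite (big_fsetD1 w) //=; apply: le_trans (_ : lam w * (u w)%:~R <= _).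
  by rewrite ler_peMr ?lam_ge0 // ler1z -gtz0_ge1 u_gt0.
rewrite lerDl big_seq sumr_ge0 // => x; rewrite !inE => /andP[_ xW].
by rewrite mulr_ge0 ?lam_ge0 // ler0z ltW ?u_gt0.
Qed.

Section Update.
Variables (Q : V -> set R) (w : V).
Hypothesis wW : w \in W.
Hypothesis Q0 : nneg_coords Q.
Local Notation Qw M := [eta Q with w |-> M].

Lemma nneg_coords_update M : M `<=` nneg_half R -> nneg_coords (Qw M).
Proof. by move=> M0 x xW /=; case: eqP => // _; exact: Q0. Qed.

Lemma coordsetU M U : coordset (Qw (M `|` U)) = coordset (Qw M) `|` coordset (Qw U).
Proof.
apply/seteqP; split=> v.
  move=> [lam [lamQ vE]]; have := lamQ w wW; rewrite /= eqxx => -[lM|lU]; [left|right];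
    by exists lam; split=> // x xW; have := lamQ x xW; rewrite /=; case: eqP => // ->.
by case=> -[lam [lamQ vE]]; exists lam; split=> // x xW; have := lamQ x xW => /=;
  case: eqP => // _; [left|right].
Qed.

Lemma coordset_disjoint M U : M `&` U = set0 -> coordset (Qw M) `&` coordset (Qw U) = set0.
Proof.
move=> MU; apply/seteqP; split=> v // [[lam [lM vl]] [mu [mU vm]]].
have := lM w wW; have := mU w wW; rewrite /= eqxx.
rewrite (independent_coord_unique W_indep (etrans (esym vl) vm) wW).
by move=> Umu Mmu; have : (M `&` U) (mu w) by []; rewrite MU.
Qed.

Lemma coordset_translate M :
  coordset (Qw [set x + 1 | x in M]) = [set v + w | v in coordset (Qw M)].
Proof.
have sumw := sum_fset_delta ir wW.
apply/seteqP; split=> [v [lam [lamQ vE]]|_ [v [lam [lamQ vE]] <-]].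
  exists (v - w); last by rewrite subrK.
  exists (fun x => lam x - (x == w)%:R); split.
    move=> x xW; have := lamQ x xW => /=; case: eqP => [_|_]; last by rewrite subr0.
    by case=> y My <-; rewrite addrK.
  under eq_bigr do rewrite scalerBl.
  by rewrite sumrB sumw -vE raddfB.
exists (fun x => lam x + (x == w)%:R); split.
  move=> x xW; have := lamQ x xW => /=; case: eqP => [_|_]; last by rewrite addr0.
  by move=> Mx; exists (lam x).
under eq_bigr do rewrite scalerDl.
by rewrite big_split /= sumw -vE raddfD.
Qed.

Lemma genfun_coordsetU M U F G : M `<=` nneg_half R -> U `<=` nneg_half R -> M `&` U = set0 ->
  genfun (level_count (coordset (Qw M))) F -> genfun (level_count (coordset (Qw U))) G ->
  genfun (level_count (coordset (Qw (M `|` U)))) (F + G).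
Proof.
move=> M0 U0 MU genM genU; apply: genfun_ext (genfunD genM genU) => n.
rewrite coordsetU level_countU //; last exact: coordset_disjoint.
- exact/coordset_level_finite/nneg_coords_update.
- exact/coordset_level_finite/nneg_coords_update.
Qed.

Variables (q : nat).
Hypothesis uw : u w = q%:Z.

Lemma level_count_coordset_translate M n : M `<=` nneg_half R ->
  level_count (coordset (Qw [set x + 1 | x in M])) n =
  cauchy 'X^q (level_count (coordset (Qw M))) n.
Proof.
move=> M0; have Qw0 := nneg_coords_update M0; rewrite coordset_translate.
apply: level_count_translate uw _ _; first exact: coordset_u_ge0.
exact: coordset_level_finite.
Qed.

Lemma genfun_coordset_translate M F : M `<=` nneg_half R ->
  genfun (level_count (coordset (Qw M))) F ->
  genfun (level_count (coordset (Qw [set x + 1 | x in M]))) (z ^+ q * F).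
Proof.
move=> M0 genM; rewrite -tofracXn; apply: genfun_ext (genfun_cauchy 'X^q genM) => n.
by rewrite level_count_coordset_translate.
Qed.

Lemma genfun_coordset_periodic M U F : M `<=` nneg_half R ->
  M = U `|` [set x + 1 | x in M] -> U `&` [set x + 1 | x in M] = set0 ->
  genfun (level_count (coordset (Qw U))) F ->
  genfun (level_count (coordset (Qw M))) (F / (1 - z ^+ q)).
Proof.
move=> M0 ME disj; have q0 : (0 < q)%N by rewrite -ltz_nat -uw u_gt0.
apply: genfun_geometric q0 _ => n; rewrite {1}ME coordsetU level_countU.
- by rewrite level_count_coordset_translate.
- by apply/coordset_level_finite/nneg_coords_update => x Ux; apply: M0; rewrite ME; left.
- by apply/coordset_level_finite/nneg_coords_update => x Mx; apply: M0; rewrite ME; right.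
- exact: coordset_disjoint.
Qed.

End Update.
End ConstrainedCoordinates.

Section Expansion.
Local Notation z := ('X%:F : ratfun).
Variables (R : realType) (d : nat) (W : {fset 'rV[int]_(d + 1)}).
Local Notation V := 'rV[int]_(d + 1).
Local Notation ir := (@int_to_real R (d + 1)%N).
Hypothesis W_indep : linearly_independent W ir.
Hypothesis u_gt0 : forall w, w \in W -> 0 < u w.
Implicit Types (S D : {fset V}) (Q : V -> set R) (M U : set R) (v w : V).
Implicit Types (F alpha beta : ratfun).

(* The integer part of the coordinate of [w] is summed out: [alpha] and [beta] are the
   generating functions of the translates of (0, 1) and of 0 that make up [M]. *)
Definition genfun_split w M alpha beta := forall Q F0 F1, nneg_coords W Q ->
  genfun (level_count (coordset W [eta Q with w |-> [set 0]])) F0 ->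
  genfun (level_count (coordset W [eta Q with w |-> unit_open R])) F1 ->
  genfun (level_count (coordset W [eta Q with w |-> M])) (alpha * F1 + beta * F0).

Section Splits.
Variables (w : V) (q : nat).
Hypothesis wW : w \in W.
Hypothesis uw : u w = q%:Z.

Lemma genfun_split_pos : genfun_split w (pos_half R)
  (1 - z ^+ q)^-1 (z ^+ q / (1 - z ^+ q)).
Proof.
move=> Q F0 F1 Q0 gen0 gen1.
rewrite (_ : _ + _ = (z ^+ q * F0 + F1) / (1 - z ^+ q)); last by ring.
apply: (genfun_coordset_periodic W_indep u_gt0 wW Q0 uw _ (@pos_half_periodic R)).
- by move=> x /ltW.
- apply/seteqP; split=> x // [+ [y y0 yx]].
  rewrite image_set1 /unit_open /pos_half /= in y0 *.
  by case=> [xE|/andP[_]]; [move: xE|]; lra.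
apply: genfun_coordsetU => //.
- by rewrite image_set1 => x ->; rewrite /nneg_half /= add0r.
- exact: unit_open_nneg.
- by apply/seteqP; split=> x //; rewrite image_set1 add0r => -[-> /andP[_]]; rewrite ltxx.
by apply: genfun_coordset_translate => //; exact: set0_nneg.
Qed.

Lemma genfun_split_nneg : genfun_split w (nneg_half R)
  (1 - z ^+ q)^-1 (1 - z ^+ q)^-1.
Proof.
move=> Q F0 F1 Q0 gen0 gen1; rewrite -mulrDr (addrC F1) mulrC.
apply: (genfun_coordset_periodic W_indep u_gt0 wW Q0 uw _ (@nneg_half_periodic R)) => //.
- apply/seteqP; split=> x // [+ [y y0 yx]]; rewrite /unit_open /nneg_half /= in y0 *.
  by case=> [xE|/andP[_]]; [move: xE|]; lra.
apply: genfun_coordsetU => //; [exact: set0_nneg|exact: unit_open_nneg|].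
by apply/seteqP; split=> x // [-> /andP[]]; rewrite ltxx.
Qed.

Lemma genfun_split_nonint : genfun_split w (nneg_nonint R) (1 - z ^+ q)^-1 0.
Proof.
move=> Q F0 F1 Q0 _ gen1; rewrite mul0r addr0 mulrC.
apply: (genfun_coordset_periodic W_indep u_gt0 wW Q0 uw _ (@nneg_nonint_periodic R)) => //.
- exact: nneg_nonint_nneg.
- apply/seteqP; split=> x // [+ [y [y0 _] yx]]; rewrite /unit_open /=.
  by case/andP; lra.
Qed.

End Splits.

Lemma coordset_open_box S : (S `<=` W)%fset ->
  coordset W (fun w => if w \in S then unit_open R else [set 0]) = open_box R S.
Proof.
move=> sub; apply/seteqP; split=> v [lam [lamQ vE]].
  exists lam; split=> [w wS|]; first by have := lamQ w (fsubsetP sub w wS); rewrite wS.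
  rewrite vE (big_fset_incl _ sub) // => w wW /negPf wS.
  by have := lamQ w wW; rewrite wS => ->; rewrite scale0r.
exists (fun w => if w \in S then lam w else 0); split.
  by move=> w wW; case: ifP => // wS; exact: lamQ.
rewrite vE -(big_fset_incl _ sub); first by apply: eq_big_seq => w ->.
by move=> w _ /negPf ->; rewrite scale0r.
Qed.

Lemma open_box_nneg S : nneg_coords W (fun w => if w \in S then unit_open R else [set 0]).
Proof. by move=> w _; case: ifP => _; [exact: unit_open_nneg|exact: set0_nneg]. Qed.

Lemma open_box_u_ge0 S v : (S `<=` W)%fset -> open_box R S v -> 0 <= u v.
Proof.
by move=> /coordset_open_box <-; apply: coordset_u_ge0 => //; exact: open_box_nneg.
Qed.

Lemma open_box_finite S : finite_set (open_box R S).
Proof.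
apply: sub_finite_set (finite_coordset R S 1) => v [lam [lamQ vE]].
by exists lam; split=> // w /lamQ /andP[/ltW lam_ge0 /ltW lam_le1]; rewrite /= lam_ge0.
Qed.

Variables (Q : V -> set R) (alpha beta : V -> ratfun).
Hypothesis Q0 : nneg_coords W Q.
Hypothesis Q_split : forall w, w \in W -> genfun_split w (Q w) (alpha w) (beta w).

Let partial D S w : set R :=
  if w \in D then Q w else if w \in S then unit_open R else [set 0].

Let genfun_partial D S : (D `<=` W)%fset -> (S `<=` W)%fset -> [disjoint D & S]%fset ->
  genfun (level_count (coordset W (partial D S)))
    (\sum_(S' <- fpowerset D) boxB R (S `|` S')%fset z *
       \prod_(w <- D) (if w \in S' then alpha w else beta w)).
Proof.
elim/fset1U_rect: D S => [|v D vD IH] S DW SW DS.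
  rewrite fpowerset0 big_seq_fset1 fsetU0 big_seq_fset0 mulr1.
  rewrite [partial _ _](_ : _ = (fun w => if w \in S then unit_open R else [set 0])) //.
  rewrite coordset_open_box //; apply: genfun_level_count; first exact: open_box_finite.
  by move=> v; exact: open_box_u_ge0.
have [vW {}DW] : v \in W /\ (D `<=` W)%fset by move: DW; rewrite fsubUset fsub1set => /andP[].
have [vS {}DS] : v \notin S /\ [disjoint D & S]%fset by move: DS; rewrite fdisjointU1X => /andP[].
have partial0 : [eta partial D S with v |-> [set 0]] = partial D S :> (V -> set R).
  apply/funext => w; rewrite /partial /=; have [->|] := eqVneq w v => //.
  by rewrite (negPf vD) (negPf vS).
have partial1 : [eta partial D S with v |-> unit_open R] =
    partial D (v |` S)%fset :> (V -> set R).
  apply/funext => w; rewrite /partial /= !inE; have [->|] := eqVneq w v => //=.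
  by rewrite (negPf vD).
have partialQ : [eta partial D S with v |-> Q v] =
    partial (v |` D)%fset S :> (V -> set R).
  by apply/funext => w; rewrite /partial /= !inE; have [->|] := eqVneq w v.
have partial_nneg : nneg_coords W (partial D S).
  by move=> w wW; rewrite /partial; case: ifP => // _; [exact: Q0|exact: open_box_nneg].
have vSW : (v |` S `<=` W)%fset by rewrite fsubUset fsub1set vW.
have DvS : [disjoint D & v |` S]%fset by rewrite fdisjointXU fdisjointX1 vD.
have := Q_split vW partial_nneg.
rewrite partial0 partial1 partialQ => /(_ _ _ (IH S DW SW DS) (IH _ DW vSW DvS)).
congr genfun; rewrite (sum_fpowersetU1_prod (fun S' => boxB R (S `|` S')%fset z)) //.
by congr (_ * _ + _); apply: eq_bigr => S' _; rewrite fsetUCA fsetUA.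
Qed.

Lemma genfun_coordset : genfun (level_count (coordset W Q))
  (\sum_(S <- fpowerset W) boxB R S z *
     \prod_(w <- W) (if w \in S then alpha w else beta w)).
Proof.
have := genfun_partial (fsubset_refl W) (fsub0set W) (fdisjointX0 _).
under eq_bigr do rewrite fset0U.
apply: genfun_ext => n; congr (level_count _ n); apply/seteqP.
by split=> v [lam [lamQ vE]]; exists lam; split=> // w wW; have := lamQ w wW; rewrite /partial wW.
Qed.

End Expansion.

(** * Simplices and denominators *)

Lemma rat_to_real_inj (R : realType) d : injective (@rat_to_real R d).
Proof.
move=> v w /rowP vw; apply/rowP => i.
by have := vw i; rewrite !mxE => /fmorph_inj.
Qed.

Section Simplices.
Variables (R : realType) (d : nat).
Implicit Types (Om Phi Psi : {fset 'rV[rat]_d}) (lam mu : 'rV[rat]_d -> R).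
Local Notation rr := (@rat_to_real R d).

Lemma sum_simplex Om (V : nmodType) (F : 'rV[R]_d -> V) :
  \sum_(w <- simplex R Om) F w = \sum_(v <- Om) F (rr v).
Proof. by rewrite big_imfset // => v w _ _; exact: rat_to_real_inj. Qed.

Lemma conv_simplexP Om x : conv (simplex R Om) x <->
  exists lam, [/\ forall v, v \in Om -> 0 <= lam v,
    \sum_(v <- Om) lam v = 1 & x = \sum_(v <- Om) lam v *: rr v].
Proof.
split=> [[lam [lam_ge0]]|[lam [lam_ge0 lam_sum1 ->]]].
  rewrite !sum_simplex => lam_sum1 lam_x; exists (fun v => lam (rr v)); split=> // v vO.
  by apply: lam_ge0; rewrite in_imfset.
have [mu muE] := extend_along_injection (in2W (@rat_to_real_inj R d)) (S := Om) lam.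
exists mu; rewrite !sum_simplex; split.
- by move=> _ /imfsetP[v /= vO ->]; rewrite muE // lam_ge0.
- by rewrite -lam_sum1; apply: eq_big_seq => v vO; rewrite muE.
- by apply: eq_big_seq => v vO; rewrite muE.
Qed.

Lemma simplex_affine Om lam : affinely_independent (simplex R Om) ->
  \sum_(v <- Om) lam v = 0 -> \sum_(v <- Om) lam v *: rr v = 0 ->
  forall v, v \in Om -> lam v = 0.
Proof.
move=> aff lam_sum0 lam_comb0 v vO.
have [mu muE] := extend_along_injection (in2W (@rat_to_real_inj R d)) (S := Om) lam.
rewrite -muE //; apply: (aff mu); last by rewrite in_imfset.
- by rewrite sum_simplex -[RHS]lam_sum0; apply: eq_big_seq => w wO; rewrite muE.
- by rewrite sum_simplex -[RHS]lam_comb0; apply: eq_big_seq => w wO; rewrite muE.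
Qed.

End Simplices.

Section MomentCurve.
Variables (R : realType) (d : nat).
Implicit Types (x f : 'rV[R]_d) (t : R).

Definition moment t : 'rV[R]_d := \row_i t ^+ i.+1.

Definition moment_poly x f : {poly R} :=
  (dot x f)%:P + \sum_(i < d) f 0 i *: 'X^(i.+1).

Lemma horner_moment_poly x f t : (moment_poly x f).[t] = dot (x + moment t) f.
Proof.
rewrite dotDl hornerD hornerC horner_sum; congr (_ + _); apply: eq_bigr => i _.
by rewrite hornerZ hornerXn mxE mulrC.
Qed.

Lemma moment_poly_neq0 x f : f != 0 -> moment_poly x f != 0.
Proof.
apply: contra => /eqP/polyP pf; apply/eqP/rowP => i; rewrite mxE.
have := pf i.+1; rewrite coefD coefC coef0 /= add0r coef_sum (bigD1 i) //=.
rewrite coefZ coefXn eqxx mulr1 big1 ?addr0 // => j ji.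
by rewrite coefZ coefXn eqSS eq_sym (inj_eq val_inj) (negPf ji) mulr0.
Qed.

Lemma horner_moment_poly_0 x f : (moment_poly x f).[0] = dot x f.
Proof.
rewrite horner_moment_poly (_ : moment 0 = 0) ?addr0 //.
by apply/rowP => i; rewrite !mxE expr0n.
Qed.

Lemma poly_neg_near0 (p : {poly R}) : p.[0] < 0 -> \forall t \near 0^'+, p.[t] < 0.
Proof.
by move=> p0; exact: (cvgr_lt _ (cvg_at_right_filter (@continuous_horner _ p 0))).
Qed.

Lemma poly_neq0_near0 (p : {poly R}) : p != 0 -> \forall t \near 0^'+, p.[t] != 0.
Proof.
move=> p_neq0; have [m [q + ->]] := multiplicity_XsubC p 0.
rewrite p_neq0 /= => q0; near=> t; rewrite hornerM horner_exp hornerXsubC subr0.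
have t0 : 0 < t by near: t; exact: nbhs_right_gt.
rewrite mulf_neq0 ?expf_neq0 ?(gt_eqF t0) //; near: t.
exact: (cvgr_neq0 _ (cvg_at_right_filter (@continuous_horner _ q 0)) q0).
Unshelve. all: by end_near. Qed.

End MomentCurve.

Section RowsWithHeight.
Variable d : nat.
Implicit Types v w : 'rV[int]_(d + 1).

Lemma u_row_mx (x : 'rV[int]_d) n : u (row_mx x (const_mx n)) = n.
Proof. by rewrite /u row_mxEr mxE. Qed.

Lemma row_mx_lsubmx_u v : v = row_mx (lsubmx v) (const_mx (u v)).
Proof.
rewrite -[LHS]hsubmxK; congr row_mx; apply/rowP => i.
by rewrite !mxE ord1.
Qed.

Lemma u_lift_vertex q (v : 'rV[rat]_d) : u (lift_vertex q v) = q%:Z.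
Proof. exact: u_row_mx. Qed.

Lemma u_apex : u (apex d) = 1.
Proof. exact: u_row_mx. Qed.

Lemma int_to_real_row_mx (R : realType) (x : 'rV[int]_d) n :
  int_to_real R (row_mx x (const_mx n : 'rV_1)) =
  row_mx (int_to_real R x) (const_mx n%:~R).
Proof. by rewrite /int_to_real map_row_mx map_const_mx. Qed.

Lemma int_to_real_apex (R : realType) :
  int_to_real R (apex d) = row_mx 0 (const_mx 1).
Proof. by rewrite int_to_real_row_mx raddf0. Qed.

End RowsWithHeight.

Section Denominator.
Variables (d : nat) (T : {fset {fset 'rV[rat]_d}}).
Implicit Types Om : {fset 'rV[rat]_d}.

Lemma biglcmn_gt0 (I : Type) (s : seq I) (F : I -> nat) :
  (forall i, (0 < F i)%N) -> (0 < \big[lcmn/1%N]_(i <- s) F i)%N.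
Proof.
by move=> F0; apply: (big_ind (fun m => (0 < m)%N)) => // m n m0 n0; rewrite lcmn_gt0 m0.
Qed.

Lemma dvdn_biglcmn_seq (I : eqType) (s : seq I) (F : I -> nat) i : i \in s ->
  (F i %| \big[lcmn/1%N]_(j <- s) F j)%N.
Proof. by move=> si; rewrite (big_rem i) //= dvdn_lcml. Qed.

Lemma denominator_gt0 : (0 < denominator T)%N.
Proof.
apply: biglcmn_gt0 => Om; apply: biglcmn_gt0 => v; apply: biglcmn_gt0 => i.
by rewrite absz_gt0 denq_eq0.
Qed.

Lemma dvdn_denominator Om v i : Om \in T -> v \in Om ->
  (absz (denq (v ord0 i)) %| denominator T)%N.
Proof.
move=> OT vO; pose vertex_lcm (w : 'rV[rat]_d) :=
  \big[lcmn/1%N]_(j < d) absz (denq (w ord0 j)).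
apply: dvdn_trans (dvdn_biglcmn_seq (fun Psi : {fset 'rV[rat]_d} =>
  \big[lcmn/1%N]_(w <- Psi) vertex_lcm w) OT).
apply: dvdn_trans (dvdn_biglcmn_seq vertex_lcm vO).
exact: (dvdn_biglcmn_seq (fun j => absz (denq (v ord0 j))) (mem_index_enum i)).
Qed.

Lemma denominator_mul_int Om v i : Om \in T -> v \in Om ->
  (denominator T)%:R * v 0 i \is a Num.int.
Proof.
move=> OT vO; have /dvdnP[k ->] := dvdn_denominator i OT vO.
rewrite natrM -mulrA rpredM ?rpred_nat //.
have -> : (absz (denq (v 0 i)))%:R = (denq (v 0 i))%:~R :> rat by rewrite pmulrn absz_denq.
by rewrite mulrC -[X in X * _]divq_num_den divfK ?intr_eq0 ?denq_eq0 // intr_int.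
Qed.

Lemma int_to_real_lsubmx_lift_vertex (R : realType) Om v : Om \in T -> v \in Om ->
  int_to_real R (lsubmx (lift_vertex (denominator T) v)) =
  (denominator T)%:R *: rat_to_real R v.
Proof.
move=> OT vO; apply/rowP => i; rewrite row_mxKl !mxE -ratr_int numqK.
  by rewrite rmorphM /= ratr_nat.
exact: denominator_mul_int OT vO.
Qed.

Lemma int_to_real_lift_vertex (R : realType) Om v : Om \in T -> v \in Om ->
  int_to_real R (lift_vertex (denominator T) v) =
  row_mx ((denominator T)%:R *: rat_to_real R v) (const_mx (denominator T)%:R).
Proof.
move=> OT vO; rewrite -(int_to_real_lsubmx_lift_vertex R OT vO).
by rewrite {1}[lift_vertex _ v]row_mx_lsubmx_u int_to_real_row_mx u_lift_vertex.
Qed.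

End Denominator.

(** * h-polynomials *)

Definition poly_frac : {pred ratfun} := fun F => `[< exists p, F = p%:F >].

Lemma poly_fracP F : reflect (exists p, F = p%:F) (F \in poly_frac).
Proof. exact: asboolP. Qed.

Lemma tofrac_poly_frac p : p%:F \in poly_frac.
Proof. by apply/poly_fracP; exists p. Qed.

Fact poly_frac_subring_closed : subring_closed poly_frac.
Proof.
split=> [|_ _ /poly_fracP[p ->] /poly_fracP[r ->]|_ _ /poly_fracP[p ->] /poly_fracP[r ->]].
- by rewrite -tofrac1 tofrac_poly_frac.
- by rewrite -tofracB tofrac_poly_frac.
- by rewrite -tofracM tofrac_poly_frac.
Qed.

HB.instance Definition _ :=
  GRing.isSubringClosed.Build ratfun poly_frac poly_frac_subring_closed.

Lemma one_sub_zXn_neq0 n : (0 < n)%N -> 1 - 'X%:F ^+ n != 0 :> ratfun.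
Proof.
by move=> n0; rewrite -tofracXn -tofrac1 -tofracB coef0_neq0 ?coef0_1subXn.
Qed.

Lemma tofracX_neq0 : 'X%:F != 0 :> ratfun.
Proof. by rewrite tofrac_eq0 polyX_eq0. Qed.

Section HPolynomials.
Local Notation z := ('X%:F : ratfun).
Variables (d : nat) (T : {fset {fset 'rV[rat]_d}}).
Hypothesis T_sub : forall Om Psi, Om \in T -> (Psi `<=` Om)%fset -> Psi \in T.
Hypothesis T_card : forall Om, Om \in T -> (#|` Om| <= d)%N.
Implicit Types (Om Phi Psi : {fset 'rV[rat]_d}) (box : {fset 'rV[rat]_d} -> ratfun).
Implicit Type y : ratfun.

(* The contribution of the cone over [Om] to the two sums over [T] defining [a_fun] and
   [b_fun]: a face [Psi] collects the points whose coordinates are fractional exactly on [Psi]. *)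
Definition face_sum (box : {fset 'rV[rat]_d} -> ratfun) (y : ratfun) Om : ratfun :=
  \sum_(Psi <- fpowerset Om)
    box Psi * ((1 - y)^-1 ^+ #|` Psi| * (y / (1 - y)) ^+ (#|` Om| - #|` Psi|)).

Lemma sum_h_face_sum box y : 1 - y != 0 ->
  \sum_(Psi <- T) box Psi * h T Psi y = (1 - y) ^+ d * \sum_(Om <- T) face_sum box y Om.
Proof.
move=> y1; have face_sumE Om : Om \in T -> face_sum box y Om =
    \sum_(Psi <- T | (Psi `<=` Om)%fset)
      box Psi * ((1 - y)^-1 ^+ #|` Psi| * (y / (1 - y)) ^+ (#|` Om| - #|` Psi|)).
  move=> OT; rewrite big_fset_condE; apply: eq_fbigl => Psi; rewrite !inE /= fpowersetE.
  by apply/idP/andP => [sub|[]//]; split=> //; exact: T_sub sub.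
rewrite (eq_big_seq _ face_sumE) (exchange_big_dep predT) //= mulr_sumr.
apply: eq_big_seq => Psi PT; rewrite -!mulr_sumr [RHS]mulrCA /h; congr (_ * _).
rewrite [RHS]mulrA; congr (_ * _).
by rewrite exprVn expfB_cond // (negPf y1) T_card.
Qed.

Lemma geometric_sum_h box q : (0 < q)%N ->
  (\sum_(i < q) z ^+ i) * \sum_(Psi <- T) box Psi * h T Psi (z ^+ q) =
  (1 - z ^+ q) ^+ d.+1 * \sum_(Om <- T) face_sum box (z ^+ q) Om / (1 - z).
Proof.
move=> q0; have z1 : 1 - z != 0 by rewrite -[z]expr1 one_sub_zXn_neq0.
rewrite sum_h_face_sum ?one_sub_zXn_neq0 // -mulr_suml mulrA [in RHS]mulrA.
apply: (canRL (mulfK z1)); rewrite mulrAC (exprS _ d); congr (_ * _).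
by rewrite mulrAC; congr (_ * _); rewrite mulrC -[RHS]opprB subrX1 -mulNr opprB.
Qed.

Lemma h_poly_frac Psi y : Psi \in T -> y \in poly_frac -> 1 - y != 0 ->
  h T Psi y \in poly_frac.
Proof.
move=> PT yP y1; rewrite /h mulr_sumr big_seq_cond rpred_sum // => Om /andP[OT _].
have le_dim : (#|` Om| - #|` Psi| <= d - #|` Psi|)%N by rewrite leq_sub2r ?T_card.
rewrite expr_div_n mulrCA -(subnK le_dim) exprD mulfK ?expf_neq0 //.
by rewrite rpredM ?rpredX ?rpredB ?rpred1.
Qed.

End HPolynomials.

(** * Cones over a boundary triangulation *)

Section Triangulation.
Local Notation z := ('X%:F : ratfun).
Variables (R : realType) (d : nat) (P : set 'rV[R]_d).
Hypothesis compactP : compact P.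
Hypothesis convexP : convex_set P.
Hypothesis P0 : interior P 0.
Variable T : {fset {fset 'rV[rat]_d}}.
Hypothesis triT : boundary_triangulation P T.
Implicit Types (Om Phi Psi : {fset 'rV[rat]_d}) (lam mu : 'rV[rat]_d -> R).
Implicit Types x y : 'rV[R]_d.
Local Notation q := (denominator T).
Local Notation rr := (@rat_to_real R d).

Definition cone_coord Om lam x := [/\ Om \in T,
  forall v, v \in Om -> 0 < lam v & x = \sum_(v <- Om) lam v *: rr v].

Lemma simplex_boundary Om x : Om \in T -> conv (simplex R Om) x -> boundary P x.
Proof. by case: triT => _ _ _ _ <- OT Ox; exists Om. Qed.

Lemma vertex_in_polytope Om v : Om \in T -> v \in Om -> P (rr v).
Proof.
move=> OT vO; have /(simplex_boundary OT) : conv (simplex R Om) (rr v).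
  by apply: conv_gen; rewrite in_imfset.
by move=> /(boundaryP compactP convexP P0)[].
Qed.

Lemma cone_coord_sum_eq0 Om lam x :
  cone_coord Om lam x -> \sum_(v <- Om) lam v = 0 -> Om = fset0.
Proof.
move=> [_ lam_gt0 _] /eqP; rewrite big_seq psumr_eq0; last by move=> v /lam_gt0/ltW.
move=> /allP lam0; apply/fsetP => v; rewrite inE; apply/negbTE/negP => vO.
by have := lam0 v vO; rewrite vO gt_eqF ?lam_gt0.
Qed.

Lemma cone_coord_sum_ge0 Om lam x :
  cone_coord Om lam x -> 0 <= \sum_(v <- Om) lam v.
Proof. by case=> _ lam_gt0 _; rewrite big_seq sumr_ge0 // => v /lam_gt0/ltW. Qed.

Lemma cone_coord_conv Om lam x : cone_coord Om lam x -> Om != fset0 ->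
  conv (simplex R Om) ((\sum_(v <- Om) lam v)^-1 *: x).
Proof.
move=> Ox Om_neq0; have [_ lam_gt0 xE] := Ox; set s := \sum_(v <- Om) lam v.
have s_neq0 : s != 0 by apply: contra Om_neq0 => /eqP/(cone_coord_sum_eq0 Ox) ->.
have s_ge0 : 0 <= s := cone_coord_sum_ge0 Ox.
apply/conv_simplexP; exists (fun v => s^-1 * lam v); split.
- by move=> v /lam_gt0/ltW lv; rewrite mulr_ge0 ?invr_ge0.
- by rewrite -mulr_sumr mulVf.
- by rewrite xE scaler_sumr; apply: eq_bigr => v _; rewrite scalerA.
Qed.

(* A hyperplane supporting [P] at the barycentre of [Om] contains all of [Om]. *)
Lemma simplex_supporting_functional Om : Om \in T ->
  exists2 y, dual P y & forall v, v \in Om -> dot (rr v) y = 1.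
Proof.
move=> OT; have [->|O0] := eqVneq Om fset0.
  by exists 0 => //; exact: dual0.
pose b := \sum_(v <- Om) (1 : R) *: rr v; pose n := \sum_(v <- Om) (1 : R).
have bO : cone_coord Om (fun=> 1) b by [].
have /(boundaryP compactP convexP P0)[_ [y Py by1]] : boundary P (n^-1 *: b).
  exact/(simplex_boundary OT)/cone_coord_conv.
have n0 : n != 0 by apply: contra O0 => /eqP/(cone_coord_sum_eq0 bO) ->.
have vy v : v \in Om -> dot (rr v) y <= 1 by move=> /(vertex_in_polytope OT)/Py.
exists y => // v vO; apply/eqP; rewrite eq_sym -subr_eq0.
have sum_y : \sum_(v <- Om) dot (rr v) y = n.
  apply: (mulfI (invr_neq0 n0)); rewrite mulVf // -by1 dotZl dot_suml.
  by under [in RHS]eq_bigr do rewrite mul1r.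
have : \sum_(v <- Om) (1 - dot (rr v) y) == 0 by rewrite sumrB sum_y subrr.
rewrite big_seq psumr_eq0 => [/allP/(_ v vO)|w /vy]; last by rewrite subr_ge0.
by rewrite vO.
Qed.

Lemma simplex_linearly_independent Om : Om \in T -> linearly_independent Om rr.
Proof.
move=> OT lam lam0; have [y _ vy] := simplex_supporting_functional OT.
have sum0 : \sum_(v <- Om) lam v = 0 by rewrite -(dot_suml_eq1 lam vy) lam0 dot0l.
by apply: simplex_affine sum0 lam0; case: triT => _ + _ _ _; apply.
Qed.

Lemma simplex_card_le Om : Om \in T -> (#|` Om| <= d)%N.
Proof. by move=> /simplex_linearly_independent/independent_card_le. Qed.

Lemma cone_coord_dot_le Om lam x y : cone_coord Om lam x -> dual P y ->
  dot x y <= \sum_(v <- Om) lam v.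
Proof.
move=> [OT lam_gt0 ->] Py; rewrite dot_suml !big_seq; apply: ler_sum => v vO.
by rewrite ler_piMr ?(ltW (lam_gt0 v vO)) //; apply/Py/vertex_in_polytope/vO.
Qed.

Lemma cone_coord_dot_attained Om lam x : cone_coord Om lam x ->
  exists2 y, dual P y & dot x y = \sum_(v <- Om) lam v.
Proof.
move=> [OT _ ->]; have [y Py vy] := simplex_supporting_functional OT.
by exists y => //; exact: dot_suml_eq1.
Qed.

Lemma cone_coord_dilate Om lam x (t : R) : cone_coord Om lam x -> 0 <= t ->
  [set t *: p | p in P] x <-> \sum_(v <- Om) lam v <= t.
Proof.
move=> Ox t_ge0; split=> [[p Pp px]|].
  have [y Py <-] := cone_coord_dot_attained Ox.
  by rewrite -px dotZl ler_piMr //; exact: Py.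
move: t_ge0; rewrite le_eqVlt => /orP[/eqP <-|t_gt0 st].
  rewrite le_eqVlt ltNge (cone_coord_sum_ge0 Ox) orbF => /eqP/(cone_coord_sum_eq0 Ox) O0.
  case: Ox => _ _ ->; rewrite O0 big_seq_fset0; exists 0; last by rewrite scaler0.
  exact: interior_subset.
exists (t^-1 *: x); last by rewrite scalerA mulfV ?gt_eqF // scale1r.
apply: (bidual compactP convexP P0) => y Py.
rewrite dotZl mulrC ler_pdivrMr // mul1r; apply: le_trans st.
exact: cone_coord_dot_le.
Qed.

Lemma cone_coord_exists x : exists Om lam, cone_coord Om lam x.
Proof.
have [->|x_neq0] := eqVneq x 0.
  by exists fset0, (fun=> 0); split; rewrite ?big_seq_fset0 //; case: triT.
have [s s_gt0 bs] := boundary_ray compactP convexP P0 x_neq0.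
case: triT => _ _ sub _ cover; move: bs; rewrite -cover.
move=> [Om /= OT /conv_simplexP[lam [lam_ge0 lam_sum1 lam_x]]].
exists [fset v in Om | 0 < lam v]%fset, (fun v => s^-1 * lam v); split.
- by apply: (sub Om) => //; apply: fset_sub.
- by move=> v; rewrite !inE /= => /andP[_ lam_v]; rewrite mulr_gt0 ?invr_gt0.
rewrite (_ : x = s^-1 *: (s *: x)); last by rewrite scalerA mulVf ?scale1r ?gt_eqF.
rewrite lam_x scaler_sumr; under [RHS]eq_bigr do rewrite -scalerA.
apply/esym/big_fset_incl; first exact: fset_sub.
move=> v vO; rewrite !inE vO /= -leNgt => lam_v.
have -> : lam v = 0 by apply/eqP; rewrite eq_le lam_v lam_ge0.
by rewrite scale0r scaler0.
Qed.

Lemma cone_coord_face Om Psi lam mu x : cone_coord Om lam x ->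
  (Psi `<=` Om)%fset -> x = \sum_(v <- Psi) mu v *: rr v -> Psi = Om.
Proof.
move=> [OT lam_gt0 ->] PO eq_x; apply/eqP; rewrite eqEfsubset PO /=; apply/fsubsetP => v vO.
pose mu0 w := if w \in Psi then mu w else 0.
have : \sum_(w <- Om) lam w *: rr w = \sum_(w <- Om) mu0 w *: rr w.
  rewrite eq_x -(big_fset_incl _ PO) => [|w _ /negPf wP]; last first.
    by rewrite /mu0 wP scale0r.
  by apply: eq_big_seq => w wP; rewrite /mu0 wP.
move=> /(independent_coord_unique (simplex_linearly_independent OT))/(_ v vO).
by rewrite /mu0; case: ifP => // _ lv; have := lam_gt0 v vO; rewrite lv ltxx.
Qed.

Lemma cone_coord_sum_unique Om Phi lam mu x : cone_coord Om lam x ->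
  cone_coord Phi mu x -> \sum_(v <- Om) lam v = \sum_(v <- Phi) mu v.
Proof.
move=> Ox Fx; have [y Py Oy] := cone_coord_dot_attained Ox.
have [y' Py' Fy'] := cone_coord_dot_attained Fx.
by apply: le_anti; rewrite -{1}Oy -{2}Fy' !cone_coord_dot_le.
Qed.

Lemma cone_coord_simplex_unique Om Phi lam mu x :
  cone_coord Om lam x -> cone_coord Phi mu x -> Om = Phi.
Proof.
move=> Ox Fx; have sumE := cone_coord_sum_unique Ox Fx.
set s := \sum_(v <- Om) lam v in sumE.
have [s0|s0] := eqVneq s 0.
  by rewrite (cone_coord_sum_eq0 Ox s0) (cone_coord_sum_eq0 Fx) // -sumE.
have neq0 Psi (nu : 'rV[rat]_d -> R) : \sum_(v <- Psi) nu v = s -> Psi != fset0.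
  by move=> sPsi; apply: contra_neq s0 => Psi0; rewrite -sPsi Psi0 big_seq_fset0.
have [[OT _ _] [FT _ _]] := (Ox, Fx).
case: (triT) => _ _ _ /(_ Om Phi OT FT)[Psi [PsO PsF cap]] _.
have : conv (simplex R Psi) (s^-1 *: x).
  rewrite -cap; split; first exact: cone_coord_conv Ox (neq0 _ _ erefl).
  by rewrite sumE; apply: cone_coord_conv Fx (neq0 _ mu _).
move=> /conv_simplexP[nu [_ _ xnu]].
have xE : x = \sum_(v <- Psi) (s * nu v) *: rr v.
  under eq_bigr do rewrite -scalerA.
  by rewrite -scaler_sumr -xnu scalerA mulfV ?scale1r.
by rewrite -(cone_coord_face Ox PsO xE) -(cone_coord_face Fx PsF xE).
Qed.

Lemma lower_cone_near Om x : Om \in T -> (#|` Om| < d)%N ->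
  \forall t \near 0^'+, forall lam, ~ cone_coord Om lam (x + moment d t).
Proof.
move=> OT Od; have indep := simplex_linearly_independent OT.
have [f f0 vf0] := independent_annihilator indep Od.
have := poly_neq0_near0 (moment_poly_neq0 x f0); apply: filterS => t pt lam [_ _ xE].
move: pt; rewrite horner_moment_poly xE dot_suml big_seq big1 ?eqxx // => v /vf0 ->.
by rewrite mulr0.
Qed.

Lemma facet_cone_near Om x : Om \in T -> #|` Om| = d ->
  ~ (exists2 lam, forall v, v \in Om -> 0 <= lam v & x = \sum_(v <- Om) lam v *: rr v) ->
  \forall t \near 0^'+, forall lam, ~ cone_coord Om lam (x + moment d t).
Proof.
move=> OT Od xN; have indep := simplex_linearly_independent OT.
have [lam xE] := independent_spanning indep Od x.
have [v vO lv] : exists2 v, v \in Om & lam v < 0.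
  apply: contrapT => lam_ge0; apply: xN; exists lam => // v vO.
  by rewrite leNgt; apply/negP => lv; apply: lam_ge0; exists v.
have [f fO] := independent_interpolation indep (fun w => (w == v)%:R).
have fE mu : dot (\sum_(w <- Om) mu w *: rr w) f = mu v.
  rewrite dot_suml -(sum_fset_delta (mu : _ -> R^o) vO); apply: eq_big_seq => w wO.
  by rewrite fO // mulrC.
have : (moment_poly x f).[0] < 0 by rewrite horner_moment_poly_0 xE fE.
move=> /poly_neg_near0; apply: filterS => t + mu [_ mu0 xtE].
by rewrite horner_moment_poly xtE fE ltNge ltW ?mu0.
Qed.

(* A point outside the cones over the facets could be perturbed along the moment
   curve to a point outside every cone. *)
Lemma facet_cone_cover x : exists Om lam, [/\ Om \in T, #|` Om| = d,
  forall v, v \in Om -> 0 <= lam v & x = \sum_(v <- Om) lam v *: rr v].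
Proof.
apply: contrapT => xN; near (0 : R)^'+ => t.
have tN : forall Om, Om \in T -> forall lam, ~ cone_coord Om lam (x + moment d t).
  near: t; apply: near_fset => Om OT; have := simplex_card_le OT.
  rewrite leq_eqVlt => /orP[/eqP Od|]; last exact: lower_cone_near.
  by apply: facet_cone_near => // -[lam lam0 xE]; apply: xN; exists Om, lam.
have [Om [lam Ot]] := cone_coord_exists (x + moment d t).
by have [OT _ _] := Ot; exact: tN OT lam Ot.
Unshelve. all: by end_near. Qed.

Lemma facet_functional_dual Om y : Om \in T -> #|` Om| = d ->
  (forall v, v \in Om -> dot (rr v) y = 1) -> dual P y.
Proof.
move=> OT Od Oy x Px; have [y' Py' Oy'] := simplex_supporting_functional OT.
have [lam xE] := independent_spanning (simplex_linearly_independent OT) Od x.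
rewrite -/(dot x y) xE (dot_suml_eq1 lam Oy) -(dot_suml_eq1 lam Oy') -xE.
exact: Py'.
Qed.

(* The sum of the cone coordinates of [x] is the gauge of [P] at [x], that is the
   maximum of [dot x] over [dual P]. *)
Definition integral_gauge := forall (x : 'rV[int]_d) Om lam,
  cone_coord Om lam (int_to_real R x) -> \sum_(v <- Om) lam v \is a Num.int.

Lemma dot_int (x y : 'rV[int]_d) :
  dot (int_to_real R x) (int_to_real R y) \is a Num.int.
Proof. by apply: rpred_sum => i _; rewrite !mxE rpredM ?intr_int. Qed.

Lemma lattice_dual_integral_gauge : lattice_polytope (dual P) -> integral_gauge.
Proof.
move=> [Y dualE] x Om lam Ox; set Z := [fset _ | _ in Y]%fset in dualE.
have [y Py yx] := cone_coord_dot_attained Ox.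
have [||z zZ zx] := @conv_dot_attained _ _ Z y (int_to_real R x).
- by rewrite -dualE.
- move=> z zZ; rewrite !(dotC _ (int_to_real R x)) yx; apply: cone_coord_dot_le Ox _.
  by rewrite dualE; exact: conv_gen.
rewrite -yx dotC -zx; case/imfsetP: zZ => z' _ ->; exact: dot_int.
Qed.

Section IntegralGauge.
Hypothesis gaugeZ : integral_gauge.

(* Adding a large multiple of the integer point [q *: \sum_(v <- Om) v] makes all the
   coordinates positive. *)
Lemma integral_gauge_span Om lam (x : 'rV[int]_d) : Om \in T ->
  int_to_real R x = \sum_(v <- Om) lam v *: rr v ->
  \sum_(v <- Om) lam v \is a Num.int.
Proof.
move=> OT xE; near \oo => N.
have lamN : forall v, v \in Om -> - lam v < N%:R.
  by near: N; apply: near_fset => v _; exact: nbhs_infty_gtr.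
have /gaugeZ : cone_coord Om (fun v => (N * q)%:R + lam v)
    (int_to_real R ((\sum_(v <- Om) lsubmx (lift_vertex q v)) *+ N + x)).
  split=> // [v vO|].
    have : (N%:R : R) <= (N * q)%:R by rewrite ler_nat leq_pmulr ?denominator_gt0.
    by have := lamN v vO; lra.
  rewrite raddfD raddfMn raddf_sum /= xE -sumrMnl -big_split /=.
  apply: eq_big_seq => v vO; rewrite (int_to_real_lsubmx_lift_vertex R OT vO).
  by rewrite scalerDl natrM -scalerA -scaler_nat.
rewrite big_split /= rpredDl // rpred_sum // => v _.
exact: rpred_nat.
Unshelve. all: by end_near. Qed.

Lemma facet_functional_integral Om : Om \in T -> #|` Om| = d ->
  exists y : 'rV[int]_d, forall v, v \in Om -> dot (rr v) (int_to_real R y) = 1.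
Proof.
move=> OT Od; have indep := simplex_linearly_independent OT.
have [y yO] := independent_interpolation indep (fun=> 1).
have y_int i : y 0 i \is a Num.int.
  have [lam lamE] := independent_spanning indep Od (delta_mx 0 i).
  rewrite -dot_delta lamE (dot_suml_eq1 lam yO).
  apply: (@integral_gauge_span Om lam (delta_mx 0 i) OT); rewrite -lamE.
  by rewrite /int_to_real map_delta_mx.
exists (\row_i Num.floor (y 0 i)) => v vO; rewrite -(yO v vO); congr dot.
by apply/rowP => i; rewrite !mxE; apply/eqP; rewrite -intrEfloor.
Qed.

Lemma integral_gauge_lattice_dual : lattice_polytope (dual P).
Proof.
pose facets := [fset Om in T | #|` Om| == d]%fset.
have facetP Om : Om \in facets = (Om \in T) && (#|` Om| == d) by rewrite !inE.
have [y yP] : exists y : {fset 'rV[rat]_d} -> 'rV[int]_d, forall Om, Om \in facets ->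
    forall v, v \in Om -> dot (rr v) (int_to_real R (y Om)) = 1.
  suff /boolp.choice[y yP] : forall Om, exists y : 'rV[int]_d, Om \in facets ->
      forall v, v \in Om -> dot (rr v) (int_to_real R y) = 1 by exists y.
  move=> Om; have [|OF] := boolP (Om \in facets); last by exists 0.
  rewrite facetP => /andP[OT /eqP Od].
  by have [y yO] := facet_functional_integral OT Od; exists y.
exists [fset y Om | Om in facets]%fset; set Y := [fset _ | _ in _]%fset.
have facet_in Om : Om \in facets -> int_to_real R (y Om) \in Y.
  by move=> OF; apply/imfsetP; exists (y Om) => //=; apply/imfsetP; exists Om.
apply/seteqP; split => z.
  move=> Pz; apply: contrapT.
  move=> /(convex_compact_separation (@conv_compact _ _ _) (@conv_convex _ _ _))[x [t [xY]]].
  have [Om [lam [OT Od lam_ge0 xE]]] := facet_cone_cover x.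
  have OF : Om \in facets by rewrite facetP OT Od eqxx.
  apply/negP; rewrite -leNgt; apply: le_trans (xY _ (conv_gen (facet_in Om OF))).
  rewrite !(dotC _ x) xE !dot_suml !big_seq.
  apply: ler_sum => v vO; rewrite yP // ler_wpM2l ?lam_ge0 //.
  by apply: Pz; apply: vertex_in_polytope vO.
move=> zY x Px; rewrite -/(dot x z) dotC.
apply: conv_dot_le zY => _ /imfsetP[_ /= /imfsetP[Om /= OF ->] ->].
rewrite dotC; move: (OF); rewrite facetP => /andP[OT /eqP Od].
by apply: (facet_functional_dual OT Od) Px; apply: yP.
Qed.

End IntegralGauge.

Local Notation ir := (@int_to_real R (d + 1)%N).
Implicit Type M : set R.

Let qR : (q%:R : R) != 0.
Proof. by rewrite pnatr_eq0 -lt0n denominator_gt0. Qed.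

Lemma lift_vertex_inj Om : Om \in T -> {in Om &, injective (@lift_vertex d q)}.
Proof.
move=> OT v w vO wO vw; apply: (@rat_to_real_inj R); apply: (scalerI qR).
have := congr1 ir vw; rewrite !(int_to_real_lift_vertex R OT) //.
by move=> /eq_row_mx[].
Qed.

Lemma lift_vertex_combination Om (nu : 'rV[rat]_d -> R) (t : R) : Om \in T ->
  t *: ir (apex d) + \sum_(v <- Om) nu v *: ir (lift_vertex q v) =
  row_mx (\sum_(v <- Om) (nu v * q%:R) *: rr v)
         (const_mx (t + \sum_(v <- Om) nu v * q%:R)).
Proof.
move=> OT; rewrite -[LHS]hsubmxK; congr row_mx.
  rewrite linearD linearZ linear_sum /= int_to_real_apex row_mxKl scaler0 add0r.
  apply: eq_big_seq => v vO.
  by rewrite linearZ /= (int_to_real_lift_vertex R OT vO) row_mxKl scalerA.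
rewrite linearD linearZ linear_sum /= int_to_real_apex row_mxKr.
apply/rowP => i; rewrite !mxE summxE mulr1; congr (_ + _).
apply: eq_big_seq => v vO.
by rewrite linearZ /= (int_to_real_lift_vertex R OT vO) row_mxKr !mxE.
Qed.

Lemma apex_notin_coneW Om : Om \in T -> apex d \notin coneW q Om.
Proof.
move=> OT; apply/imfsetP => -[v /= vO /(congr1 ir)].
rewrite (int_to_real_lift_vertex R OT vO) int_to_real_apex.
move=> /eq_row_mx[/esym/eqP + _]; rewrite scaler_eq0 (negPf qR) /= => /eqP v0.
have [y _ /(_ v vO)] := simplex_supporting_functional OT.
by rewrite v0 dot0l => /eqP; rewrite eq_sym oner_eq0.
Qed.

Lemma sum_apex_coneW Om (V : nmodType) (F : 'rV[int]_(d + 1) -> V) : Om \in T ->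
  \sum_(w <- (apex d |` coneW q Om)%fset) F w =
  F (apex d) + \sum_(v <- Om) F (lift_vertex q v).
Proof.
move=> OT; rewrite big_fsetU1 ?apex_notin_coneW // big_imfset //.
exact: lift_vertex_inj.
Qed.

Lemma apex_coneW_independent Om : Om \in T ->
  linearly_independent (apex d |` coneW q Om)%fset ir.
Proof.
move=> OT lam; rewrite sum_apex_coneW // lift_vertex_combination //.
rewrite -row_mx0 => /eq_row_mx[lam_Om lam_apex].
have lam_lift v : v \in Om -> lam (lift_vertex q v) = 0.
  move=> vO; have := simplex_linearly_independent OT lam_Om vO.
  by move=> /eqP; rewrite mulf_eq0 (negPf qR) orbF => /eqP.
move=> w; rewrite !inE => /orP[/eqP ->|/imfsetP[v /= vO ->]]; last exact: lam_lift.
have := congr1 (fun N : 'rV[R]_1 => N 0 0) lam_apex; rewrite !mxE big_seq big1 ?addr0 //.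
by move=> v vO; rewrite lam_lift ?mul0r.
Qed.

Lemma apex_coneW_u_gt0 Om w : w \in (apex d |` coneW q Om)%fset -> 0 < u w.
Proof.
rewrite !inE => /orP[/eqP ->|/imfsetP[v /= _ ->]]; first by rewrite u_apex.
by rewrite u_lift_vertex ltz_nat denominator_gt0.
Qed.

Definition apex_cone Om M : set 'rV[int]_(d + 1) :=
  coordset (apex d |` coneW q Om)%fset [eta (fun=> pos_half R) with apex d |-> M].

Lemma apex_coneP Om M v : Om \in T ->
  apex_cone Om M v <-> exists lam t, [/\ cone_coord Om lam (int_to_real R (lsubmx v)),
    M t & (u v)%:~R = t + \sum_(r <- Om) lam r].
Proof.
move=> OT; have q_gt0 : (0 : R) < q%:R by rewrite ltr0n denominator_gt0.
have liftN r : r \in Om -> (lift_vertex q r == apex d) = false.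
  by move=> rO; apply: contraNF (apex_notin_coneW OT) => /eqP <-; rewrite in_imfset.
split=> [[lam [lamQ]]|[lam [t [[_ lam_gt0 xE] Mt uE]]]].
  rewrite sum_apex_coneW // lift_vertex_combination // {1}(row_mx_lsubmx_u v).
  rewrite int_to_real_row_mx => /eq_row_mx[xE /rowP/(_ 0)]; rewrite !mxE => uE.
  exists (fun r => lam (lift_vertex q r) * q%:R), (lam (apex d)); split=> //.
    split=> // r rO; rewrite mulr_gt0 //; have := lamQ (lift_vertex q r).
    by rewrite /= liftN // fset1Ur ?in_imfset // => /(_ isT).
  by have := lamQ _ (fset1U1 _ _); rewrite /= eqxx.
have [nu nuE] := extend_along_injection (lift_vertex_inj OT) (fun r => lam r / q%:R).
exists (fun w => if w == apex d then t else nu w); split.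
  move=> w; rewrite !inE /=; case: eqP => //= _ /imfsetP[r /= rO ->].
  by rewrite nuE //; apply: divr_gt0; rewrite ?lam_gt0.
rewrite sum_apex_coneW // eqxx {1}(row_mx_lsubmx_u v) int_to_real_row_mx xE uE.
rewrite (eq_big_seq (fun r => (lam r / q%:R) *: ir (lift_vertex q r))).
  rewrite lift_vertex_combination //.
  by congr (row_mx _ (const_mx (_ + _))); apply: eq_bigr => r _; rewrite divfK.
by move=> r rO; rewrite liftN // nuE.
Qed.

Lemma apex_cone_nneg_coords Om M : M `<=` nneg_half R ->
  nneg_coords (apex d |` coneW q Om)%fset [eta (fun=> pos_half R) with apex d |-> M].
Proof. by move=> M0 w _ /=; case: eqP => // _ x /ltW. Qed.

Lemma apex_cone_u_ge0 Om M : M `<=` nneg_half R -> forall v, apex_cone Om M v -> 0 <= u v.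
Proof.
move=> /(apex_cone_nneg_coords (Om := Om)); apply: coordset_u_ge0.
exact: apex_coneW_u_gt0.
Qed.

Lemma apex_cone_level_finite Om M : M `<=` nneg_half R -> level_finite (apex_cone Om M).
Proof.
move=> /(apex_cone_nneg_coords (Om := Om)); apply: coordset_level_finite.
exact: apex_coneW_u_gt0.
Qed.

Lemma apex_cone_trivIset M : trivIset [set` T] (fun Om => apex_cone Om M).
Proof.
move=> Om Phi /= OT FT [v [/(apex_coneP _ _ OT)[lam [t [Ov _ _]]]]].
move=> /(apex_coneP _ _ FT)[lam' [t' [Fv _ _]]].
exact: (cone_coord_simplex_unique Ov Fv).
Qed.

Lemma bigcup_apex_cone_nneg v : 0 <= u v ->
  (\bigcup_(Om in [set` T]) apex_cone Om (nneg_half R)) v <->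
  [set (u v)%:~R *: p | p in P] (int_to_real R (lsubmx v)).
Proof.
move=> uv; have {}uv : 0 <= (u v)%:~R :> R by rewrite ler0z.
have dilate := cone_coord_dilate _ uv.
split=> [[Om /= OT /(apex_coneP _ _ OT)[lam [t [Ov t_ge0 uE]]]]|vP].
  by apply/(dilate _ _ _ Ov); rewrite uE lerDr.
have [Om [lam Ov]] := cone_coord_exists (int_to_real R (lsubmx v)).
have OT : Om \in T by case: Ov.
exists Om => //; apply/(apex_coneP _ _ OT).
exists lam, ((u v)%:~R - \sum_(r <- Om) lam r); rewrite subrK; split=> //.
by rewrite /nneg_half /= subr_ge0; apply/(dilate _ _ _ Ov).
Qed.

Lemma lattice_count_apex_cone n : (lattice_count P n)%:R =
  \sum_(Om <- T) level_count (apex_cone Om (nneg_half R)) n :> rat.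
Proof.
have finC Om : Om \in T -> level_finite (apex_cone Om (nneg_half R)).
  by move=> _; exact: apex_cone_level_finite.
rewrite -level_count_bigcup ?fset_uniq //; last exact: apex_cone_trivIset.
have finU := level_finite_bigcup finC n; set U := \bigcup_(Om in _) _ in finU *.
rewrite /level_count /lattice_count; congr (_%:R).
have -> : [set x : 'rV[int]_d | [set n%:R *: p | p in P] (int_to_real R x)] =
    [set lsubmx v | v in U `&` level n].
  apply/seteqP; split=> [x nPx|_ [v [Uv uv] <-]]; last first.
    have := @bigcup_apex_cone_nneg v; rewrite uv => /(_ isT) [+ _]; exact.
  exists (row_mx x (const_mx n%:Z)); last by rewrite row_mxKl.
  split; last by rewrite /level /= u_row_mx.
  by apply/bigcup_apex_cone_nneg; rewrite u_row_mx // row_mxKl.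
rewrite fset_set_image // card_in_imfset //= => v w.
rewrite !in_fset_set // !inE => -[_ uv] [_ uw] vw.
by rewrite (row_mx_lsubmx_u v) (row_mx_lsubmx_u w) vw uv uw.
Qed.

Lemma integral_gauge_apex_cone : integral_gauge <->
  forall Om, Om \in T -> apex_cone Om (nneg_nonint R) = set0.
Proof.
split=> [gaugeZ Om OT|empty x Om lam Ox].
  apply/seteqP; split=> v // /(apex_coneP _ _ OT)[lam [t [Ov [_ /negP tN] uE]]].
  by apply: tN; rewrite -(rpredDr _ (gaugeZ _ _ _ Ov)) -uE intr_int.
have OT : Om \in T by case: Ox.
apply: contrapT => /negP sN; set s := \sum_(v <- Om) lam v in sN.
pose n := Num.bound s; have s0 : 0 <= s := cone_coord_sum_ge0 Ox.
suff : apex_cone Om (nneg_nonint R) (row_mx x (const_mx n%:Z)) by rewrite empty.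
apply/apex_coneP => //; exists lam, (n%:R - s).
rewrite row_mxKl u_row_mx subrK; split=> //; split.
  by rewrite subr_ge0 ltW // archi_boundP.
by rewrite rpredBl ?rpred_nat // rpredN.
Qed.

Lemma prod_coneW_if (a b : ratfun) Om Psi : Om \in T -> (Psi `<=` Om)%fset ->
  \prod_(w <- coneW q Om) (if w \in coneW q Psi then a else b) =
  a ^+ #|` Psi| * b ^+ (#|` Om| - #|` Psi|).
Proof.
move=> OT sub; have card_coneW Phi : (Phi `<=` Om)%fset -> #|` coneW q Phi| = #|` Phi|.
  move=> /fsubsetP FO; apply: card_in_imfset => v w vF wF.
  exact: lift_vertex_inj OT _ _ (FO v vF) (FO w wF).
rewrite prod_fset_if ?card_coneW //.
by apply: subset_imfset; exact/fsubsetP.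
Qed.

Lemma genfun_apex_cone Om M alpha beta : Om \in T -> M `<=` nneg_half R ->
  genfun_split (apex d |` coneW q Om)%fset (apex d) M alpha beta ->
  genfun (level_count (apex_cone Om M))
    (alpha * face_sum (fun Psi => B' R q Psi z) (z ^+ q) Om +
     beta * face_sum (fun Psi => B R q Psi z) (z ^+ q) Om).
Proof.
move=> OT M0 splitM; pose z1 := (1 - z ^+ q)^-1.
pose gamma w := if w == apex d then alpha else z1.
pose delta w := if w == apex d then beta else z ^+ q * z1.
have aN := apex_notin_coneW OT.
have split_all w : w \in (apex d |` coneW q Om)%fset ->
    genfun_split (apex d |` coneW q Om)%fset w
      ([eta (fun=> pos_half R) with apex d |-> M] w) (gamma w) (delta w).
  rewrite /gamma /delta /=; case: eqP => [-> //|wN wW].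
  apply: genfun_split_pos => //; first exact: apex_coneW_independent.
  - exact: apex_coneW_u_gt0.
  - by move: wW; rewrite !inE => /orP[/eqP//|/imfsetP[v _ ->]]; exact: u_lift_vertex.
have := genfun_coordset (@apex_coneW_u_gt0 Om) (apex_cone_nneg_coords M0) split_all.
have face_sumE (F : {fset 'rV[int]_(d + 1)} -> ratfun) :
    \sum_(S <- fpowerset (coneW q Om)) F S *
      \prod_(w <- coneW q Om) (if w \in S then gamma w else delta w) =
    face_sum (fun Psi => F (coneW q Psi)) (z ^+ q) Om.
  rewrite (sum_fpowerset_imfset _ (lift_vertex_inj OT)); apply: eq_big_seq => Psi.
  rewrite fpowersetE -/(coneW q Psi) => sub; rewrite -prod_coneW_if //; congr (_ * _).
  apply: eq_big_seq => w wC; rewrite /gamma /delta.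
  by case: eqP => // wa; rewrite -wa wC in aN.
congr genfun; rewrite sum_fpowersetU1_prod // /gamma /delta eqxx.
by rewrite -/gamma -/delta (face_sumE (fun S => boxB R (apex d |` S)%fset z)) face_sumE.
Qed.

Let T_sub Om Psi : Om \in T -> (Psi `<=` Om)%fset -> Psi \in T.
Proof. by case: triT => _ _ + _ _; apply. Qed.

Let T_card Om : Om \in T -> (#|` Om| <= d)%N.
Proof. exact: simplex_card_le. Qed.

Let one_sub_zq_neq0 : 1 - z ^+ q != 0.
Proof. exact/one_sub_zXn_neq0/denominator_gt0. Qed.

Let box_sum := face_sum (fun Psi => B R q Psi z) (z ^+ q).
Let box_sum' := face_sum (fun Psi => B' R q Psi z) (z ^+ q).

Lemma genfun_apex_cone_nneg Om : Om \in T ->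
  genfun (level_count (apex_cone Om (nneg_half R)))
    ((box_sum Om + box_sum' Om) / (1 - z)).
Proof.
move=> OT; have := genfun_apex_cone OT (@subset_refl _ _)
  (genfun_split_nneg (apex_coneW_independent OT)
    (@apex_coneW_u_gt0 Om) (fset1U1 _ _) (u_apex d)).
by rewrite expr1 -mulrDr mulrC addrC.
Qed.

Lemma genfun_apex_cone_nonint Om : Om \in T ->
  genfun (level_count (apex_cone Om (nneg_nonint R))) (box_sum' Om / (1 - z)).
Proof.
move=> OT; have := genfun_apex_cone OT (@nneg_nonint_nneg R)
  (genfun_split_nonint (apex_coneW_independent OT)
    (@apex_coneW_u_gt0 Om) (fset1U1 _ _) (u_apex d)).
by rewrite expr1 mul0r addr0 mulrC.
Qed.

Lemma a_fun_box_sum : a_fun R T z =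
  (1 - z ^+ q) ^+ d.+1 * \sum_(Om <- T) box_sum Om / (1 - z).
Proof. exact/geometric_sum_h/denominator_gt0. Qed.

Lemma z_mul_b_fun : z * b_fun R T z =
  (\sum_(i < q) z ^+ i) * \sum_(Om <- T) B' R q Om z * h T Om (z ^+ q).
Proof. by rewrite /b_fun !mulrA mulfV ?tofracX_neq0 // mul1r. Qed.

Lemma z_mul_b_fun_box_sum : z * b_fun R T z =
  (1 - z ^+ q) ^+ d.+1 * \sum_(Om <- T) box_sum' Om / (1 - z).
Proof. by rewrite z_mul_b_fun; apply/geometric_sum_h/denominator_gt0. Qed.

Lemma genfun_hstar : genfun
  (cauchy ((1 - 'X^q) ^+ d.+1) (fun n => (lattice_count P n)%:R))
  (a_fun R T z + z * b_fun R T z).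
Proof.
rewrite a_fun_box_sum z_mul_b_fun_box_sum -mulrDr -big_split /=.
under eq_bigr do rewrite -mulrDl.
rewrite -[1 - z ^+ q](_ : (1 - 'X^q)%:F = _); last by rewrite tofracB tofrac1 tofracXn.
rewrite -tofracXn; apply: genfun_cauchy.
apply: genfun_ext (genfun_sum genfun_apex_cone_nneg) => n.
by rewrite lattice_count_apex_cone.
Qed.

Lemma hstarP hs : is_hstar P q hs <-> hs%:F = a_fun R T z + z * b_fun R T z.
Proof.
split=> [hsP|hsE n]; last first.
  by have := genfun_hstar; rewrite -hsE => /genfun_polyP/(_ n).
apply: genfun_unique genfun_hstar; apply: genfun_ext (genfun_poly hs) => n.
by rewrite -hsP.
Qed.

Lemma box_sum_h_poly_frac (W : {fset 'rV[rat]_d} -> {fset 'rV[int]_(d + 1)}) :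
  (forall Om w, Om \in T -> w \in W Om -> 0 < u w) ->
  (\sum_(i < q) z ^+ i) * \sum_(Om <- T) boxB R (W Om) z * h T Om (z ^+ q) \in poly_frac.
Proof.
move=> W_gt0; have z_poly := tofrac_poly_frac 'X.
rewrite rpredM //; first by apply: rpred_sum => i _; exact: rpredX.
rewrite big_seq rpred_sum // => Om OT; rewrite rpredM ?h_poly_frac ?rpredX //.
rewrite /boxB sum_level_poly ?tofrac_poly_frac //; first exact: open_box_finite.
by move=> v; apply: (open_box_u_ge0 (W_gt0 Om ^~ OT) (fsubset_refl _)).
Qed.

Lemma hstar_exists : exists hs, is_hstar P q hs.
Proof.
have /poly_fracP[hs /esym/hstarP] : a_fun R T z + z * b_fun R T z \in poly_frac.
  rewrite rpredD // ?z_mul_b_fun; apply: box_sum_h_poly_frac => Om w _ wW.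
    exact/(@apex_coneW_u_gt0 Om)/fset1Ur.
  exact: (@apex_coneW_u_gt0 Om).
by exists hs.
Qed.

Lemma b_fun_eq0 : b_fun R T z = 0 <-> integral_gauge.
Proof.
have -> : b_fun R T z = 0 <-> \sum_(Om <- T) box_sum' Om / (1 - z) = 0.
  have : z * b_fun R T z == 0 = (\sum_(Om <- T) box_sum' Om / (1 - z) == 0).
    by rewrite z_mul_b_fun_box_sum mulf_eq0 (negPf (expf_neq0 _ one_sub_zq_neq0)).
  rewrite mulf_eq0 (negPf tofracX_neq0) /= => eq0.
  by split=> /eqP sum0; apply/eqP; [rewrite -eq0|rewrite eq0].
rewrite (genfun_eq0 (genfun_sum genfun_apex_cone_nonint)) integral_gauge_apex_cone.
have countP Om := level_count_eq0 (apex_cone_level_finite Om (@nneg_nonint_nneg R))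
  (apex_cone_u_ge0 (@nneg_nonint_nneg R)).
split=> [count0 Om OT|empty n]; last first.
  by rewrite big_seq big1 // => Om OT; rewrite empty // level_count_set0.
apply/countP => n; have /eqP := count0 n.
by rewrite psumr_eq0 => [/allP/(_ Om OT)/eqP|Phi _]; rewrite ?ler0n.
Qed.

Lemma lattice_dualP : lattice_polytope (dual P) <-> integral_gauge.
Proof.
split; first exact: lattice_dual_integral_gauge.
exact: integral_gauge_lattice_dual.
Qed.

End Triangulation.

Theorem theorem5p1 (R : realType) (d : nat) (P : set 'rV[R]_d)
    (T : {fset {fset 'rV[rat]_d}}) :
  rational_polytope P -> interior P 0 -> boundary_triangulation P T ->
  let q := denominator T in
  let z := polyF 'X in
  let a := a_fun R T z in
  let b := b_fun R T z in
  (exists hstar : {poly rat}, is_hstar P q hstar) /\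
  forall hstar : {poly rat}, is_hstar P q hstar ->
    [/\ polyF hstar = a + z * b,
        lattice_polytope (dual P) <-> b = 0 &
        lattice_polytope (dual P) <-> polyF hstar = a].
Proof.
move=> [A PE] P0 triT q z a b.
have compactP : compact P by rewrite PE; exact: conv_compact.
have convexP : convex_set P by rewrite PE; exact: conv_convex.
split; first exact: (hstar_exists compactP convexP P0 triT).
move=> hs hsP; have hsE : polyF hs = a + z * b.
  exact/(hstarP compactP convexP P0 triT).
have dual_b0 : lattice_polytope (dual P) <-> b = 0.
  by rewrite (lattice_dualP compactP convexP P0 triT) (b_fun_eq0 compactP convexP P0 triT).
split=> //; rewrite dual_b0 hsE.
split=> [->|/eqP]; first by rewrite mulr0 addr0.
by rewrite -subr_eq0 addrAC subrr add0r mulf_eq0 (negPf tofracX_neq0) => /eqP.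
Qed.
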